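(* Let $C>0$ and suppose that $f:[C,\infty)\to(0,\infty)$ is a continuous nondecreasing function which is regularly varying (in the sense defined in the context). Define $F(t)=\int_C^t f(x)\,dx$ for $t\ge C$. Then for (Lebesgue) almost every $\theta$: (i) if $\int_C^\infty \frac{dx}{f(x)}<\infty$, then $\rho_n\in o(F(\log n))$, i.e. $\rho_n(x)\in o(F(\log n))$ for every $x\in[0,1)$; (ii) if $\int_C^\infty \frac{dx}{f(x)}=\infty$, then $\rho_n\notin o(f(\log n))$, i.e. $\rho_n(x)\notin o(f(\log n))$ for every $x\in[0,1)$.
   Context: For irrational $\theta\in(0,1)$ and $x\in[0,1)$, the $1/2$-discrepancy sums are $$S_i(x)=\sum_{j=0}^{i-1}\left(\chi_{[0,1/2)}-\chi_{[1/2,1)}\right)(x+j\theta),$$ with addition modulo one ($\chi$ denotes an indicator function), and $$\rho_n(x)=1+\max\{S_i(x):i=1,\ldots,n\}-\min\{S_i(x):i=1,\ldots,n\}.$$ The notation $\rho_n\in o(b_n)$ means $\rho_n(x)\in o(b_n)$ for every $x\in[0,1)$, and $\rho_n\notin o(b_n)$ means that for every $x\in[0,1)$, $\rho_n(x)\notin o(b_n)$; asymptotics are as $n\to\infty$. A function $f$ is called regularly varying if for every $K>0$ one has $f(Kx)\sim f(x)$ as $x\to\infty$, where $u(x)\sim v(x)$ means that the ratio $u(x)/v(x)$ stays between two positive finite constants for all sufficiently large $x$ (the constants may depend on $K$). *)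

(* Defs.v *)
From HB Require Import structures.
From mathcomp Require Import all_boot all_order all_algebra.
From mathcomp Require Import all_classical all_reals all_analysis.

Set Implicit Arguments.
Unset Strict Implicit.
Unset Printing Implicit Defensive.

Import Order.TTheory GRing.Theory Num.Theory.
Import numFieldNormedType.Exports.

Local Open Scope classical_set_scope.
Local Open Scope ring_scope.

Section Discrepancy.
Variable R : realType.
Implicit Types (theta x y : R) (i n : nat).

Definition frac_part y : R := y - (Num.floor y)%:~R.

Definition half_sign y : R := \1_(`[0, 2^-1[ : set R) y - \1_(`[2^-1, 1[ : set R) y.

Definition discr_sum theta x i : R :=
  \sum_(0 <= j < i) half_sign (frac_part (x + j%:R * theta)).

(* The default value of both extrema is the term i = 1, so that for n >= 1
   they are the maximum and the minimum over 1 <= i <= n; the value at n = 0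
   (which is 1) has no meaning and plays no role in the asymptotics. *)
Definition rho theta x n : R :=
  1 + \big[Num.max/discr_sum theta x 1]_(1 <= i < n.+1) discr_sum theta x i
    - \big[Num.min/discr_sum theta x 1]_(1 <= i < n.+1) discr_sum theta x i.

End Discrepancy.

Section RegularVariation.
Variable R : realType.
Implicit Types u v f : R -> R.

(* This is weaker than asymptotic equivalence (u / v --> 1). *)
Definition same_order u v : Prop :=
  exists a b : R, [/\ 0 < a, 0 < b & \forall x \near +oo, a <= u x / v x <= b].

(* A function on [C, +oo[ is represented by a total function; only its values
   near +oo matter here. *)
Definition regularly_varying f : Prop :=
  forall K : R, 0 < K -> same_order (fun x => f (K * x)) f.

End RegularVariation.

(* Main.v *)
Require Import Defs.
From HB Require Import structures.
From mathcomp Require Import all_boot all_order all_algebra.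
From mathcomp Require Import all_classical all_reals all_analysis.
From mathcomp Require Import measurable_realfun.
From mathcomp Require Import ring lra zify.

Set Implicit Arguments.
Unset Strict Implicit.
Unset Printing Implicit Defensive.

Import Order.TTheory GRing.Theory Num.Theory.
Import numFieldNormedType.Exports.

Local Open Scope classical_set_scope.
Local Open Scope ring_scope.

(** The discrepancy of the rotation by theta is governed by the rational numbers
    p/q close to theta, and the two statements are the two halves of Khinchin's
    theorem on such approximations.

    Upper bound.  If p/q is reduced and |theta - p/q| <= 1/q^2, then the sums of
    length q are bounded by 10, from every starting point ([denjoy_koksma]).
    For q <= 2^j with |q theta - p| < 2^-j ([dirichlet]), a sum of length less
    than 2^(j+1) is made of at most 2^(j+1)/q blocks of length q and of a sum
    of length less than 2^j.  So the maximal discrepancy grows by at most a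
    constant times 2^j/q between the times 2^j and 2^(j+1)
    ([discr_sum_dyadic]).  The set of the theta in ]0, 1[ with such
    a p/q for which 2^j/q >= b j has measure at most 4 / b j.  By Borel-Cantelli, if the sum of the
    1 / b j is finite, then almost surely 2^j/q < b j for all large j
    ([eventually_badly_approximable]).  When 1/f is integrable, this applies to
    b j = eta * f (C + (j+1) ln 2) for each eta > 0, and the sum of the b j over
    the levels up to log n is at most a constant times eta * F (log n); the
    shift of the argument of f is absorbed by its regular variation.  This gives
    [rho_littleo].

    Lower bound.  If q is odd, then a sum of q signs is not zero, and if
    |theta - p/q| < 1/(4 J q^2), then the sums over J consecutive blocks of
    length q are all equal, either from the time 0 or from the time J q, because
    the orbit drifts slowly with respect to the rotation by p/q.  Hence rho is at least
    J at the time 2 J q ([rho_ge]), whatever the starting point.  A convergent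
    with odd denominator q_k followed by a digit a_(k+1) >= 4 J is such a p/q.
    Given the first k digits, the digit a_(k+1) is at least h with probability at
    least 1/h, and at least one of two consecutive denominators is odd.  So if h
    is nondecreasing and the sum of the 1 / h k diverges, then a_(k+1) >= h k for
    infinitely many k with q_k odd, almost surely
    ([frequent_large_digits]).  To compare the thresholds with the logarithm
    of the time one needs an exponential bound on the denominators:
    q_k <= 16^k for all large k, almost surely ([cden_growth]).  When
    the integral of 1/f diverges, the thresholds h k = 4 * ht k, with ht k just
    above f (C + (k+1) ln 16), have a divergent sum of inverses, and the lower
    bound follows ([rho_not_littleo]).

    Both almost sure statements on digits are proved by bounding the measure of a
    tree of continued fraction cylinders with a potential ([tree_measure]). *)

(** * Partial sums and their range *)

Section Rotation.
Variable R : realType.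
Implicit Types (theta x y : R) (i j n p q : nat).

(** The map y |-> half_sign (frac_part y) alternates on the intervals
    [k/2, (k+1)/2[, so that its sign can be read off the integer part of 2y;
    all the estimates below go through this integer. *)
Lemma half_sign_frac y (k : int) : k%:~R <= 2 * y < (k + 1)%:~R ->
  half_sign (frac_part y) = (-1) ^+ odd `|k|.
Proof.
move=> /andP[k1 k2].
have fl := floor_itv y.
move: fl; set F := Num.floor y => /andP[F1 F2].
rewrite /half_sign /frac_part -/F !indicE !mem_setE !in_itv /=.
have [fl|fl] := ltP (y - F%:~R) 2^-1.
- have -> : k = 2 * F.
    apply/eqP; rewrite eq_le -!ltzD1 -!(ltr_int R).
    by apply/andP; split; lra.
  have -> : odd `|2 * F| = false by lia.
  have -> : 0 <= y - F%:~R by lra.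
  by rewrite /= subr0.
- have -> : k = 2 * F + 1.
    apply/eqP; rewrite eq_le -!ltzD1 -!(ltr_int R).
    by apply/andP; split; lra.
  have -> : odd `|2 * F + 1| = true by lia.
  have -> : 0 <= y - F%:~R by lra.
  have -> : y - F%:~R < 1 by lra.
  by rewrite /= sub0r expr1.
Qed.

Lemma half_sign_frac_norm y : `|half_sign (frac_part y)| = 1.
Proof.
rewrite (@half_sign_frac y (Num.floor (2 * y))) ?normrX ?normrN1 ?expr1n //.
exact: floor_itv.
Qed.

Lemma discr_sumD theta x m n :
  discr_sum theta x (m + n) =
  discr_sum theta x m + discr_sum theta (x + m%:R * theta) n.
Proof.
rewrite /discr_sum (@big_cat_nat _ _ _ m) ?leq_addr//=; congr (_ + _).
rewrite -{1}[m]add0n big_addn addKn; apply: eq_bigr => j _.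
by rewrite natrD; congr (half_sign (frac_part _)); ring.
Qed.

Lemma discr_sum_norm theta x n : `|discr_sum theta x n| <= n%:R.
Proof.
apply: (le_trans (ler_norm_sum _ _ _)).
under eq_bigr do rewrite half_sign_frac_norm.
by rewrite big_const_nat subn0 iter_addr_0.
Qed.

(** Only the partial sums with index at least 1 enter rho, so the empty sum
    cannot be used as one of the two terms. *)
Lemma rho_ge_diff theta x N i j : (0 < i <= N)%N -> (0 < j <= N)%N ->
  1 + `|discr_sum theta x i - discr_sum theta x j| <= rho theta x N.
Proof.
move=> /andP[i0 iN] /andP[j0 jN]; rewrite /rho.
set M := \big[Num.max/_]_(_ <= _ < _) _; set m := \big[Num.min/_]_(_ <= _ < _) _.
have Mx k : (0 < k <= N)%N -> discr_sum theta x k <= M.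
  by move=> kN; apply: le_bigmax_seq => //; rewrite mem_index_iota.
have mx k : (0 < k <= N)%N -> m <= discr_sum theta x k.
  by move=> kN; apply: ge_bigmin_seq => //; rewrite mem_index_iota.
have := Mx i; have := Mx j; have := mx i; have := mx j.
rewrite i0 iN j0 jN => /(_ isT) h1 /(_ isT) h2 /(_ isT) h3 /(_ isT) h4.
by case: ler0P => _; lra.
Qed.

Lemma rho_ge1 theta x N : 1 <= rho theta x N.
Proof.
case: N => [|N]; first by rewrite /rho !big_geq // addrK.
by have := @rho_ge_diff theta x N.+1 1%N 1%N isT isT; rewrite subrr normr0 addr0.
Qed.

Lemma rho_le theta x N (B : R) : (0 < N)%N ->
  (forall i, (i <= N)%N -> `|discr_sum theta x i| <= B) ->
  rho theta x N <= 1 + 2 * B.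
Proof.
move=> N0 H; rewrite /rho.
set M := \big[Num.max/_]_(_ <= _ < _) _; set m := \big[Num.min/_]_(_ <= _ < _) _.
have MB : M <= B.
  rewrite /M big_nat; apply: bigmax_le; first exact: le_trans (ler_norm _) (H _ N0).
  by move=> i /andP[_ iN]; exact: le_trans (ler_norm _) (H _ iN).
have mB : - B <= m.
  have H' k : (k <= N)%N -> - B <= discr_sum theta x k.
    by move=> kN; have := H _ kN; rewrite ler_norml => /andP[].
  rewrite /m big_nat; apply: le_bigmin; first exact: H'.
  by move=> i /andP[_ iN]; exact: H'.
by lra.
Qed.

End Rotation.

(** * Lower bound from an odd denominator *)

Section Lower.
Variable R : realType.
Implicit Types (theta x y : R) (i j n p q : nat).

Let int2 : (2 : int)%:~R = 2 :> R. Proof. by []. Qed.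

Let int_adjacent (a b c : int) :
  a <= b -> b <= c -> c <= a + 1 -> a != b -> b = c.
Proof. lia. Qed.

Let sgnz (k : int) : R := (-1) ^+ odd `|k|.

Lemma half_sign_frac_div x q (a : int) : (0 < q)%N ->
  a%:~R <= 2 * (q%:R * x) < (a + 1)%:~R ->
  half_sign (frac_part x) = sgnz (a %/ q%:Z)%Z.
Proof.
move=> q0 /andP[a1 a2]; apply: half_sign_frac.
have q0z : q%:Z != 0 by lia.
have q0r : 0 < q%:R :> R by rewrite ltr0n.
have e := divz_eq a q%:Z.
have r0 := modz_ge0 a q0z.
have r1 : ((a %% q%:Z)%Z + 1 <= q%:Z) by rewrite lezD1 ltz_pmod //; lia.
set k := (a %/ q%:Z)%Z in e *; set r := (a %% q%:Z)%Z in e r0 r1 *.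
have eR : a%:~R = k%:~R * q%:R + r%:~R :> R by rewrite e !intrD intrM.
have r0R : 0 <= r%:~R :> R by rewrite ler0z.
have r1R : r%:~R + 1 <= q%:R :> R by rewrite -[1]/(1%:~R) -intrD pmulrn ler_int.
move: a1 a2; rewrite !intrD eR => a1 a2.
apply/andP; split.
  rewrite -(ler_pM2r q0r); lra.
by rewrite -(ltr_pM2r q0r); lra.
Qed.

(** An odd number of signs cannot cancel. *)
Lemma sgnz_sum_odd (q : nat) (u : nat -> int) : odd q ->
  1 <= `|\sum_(0 <= m < q) sgnz (u m)|.
Proof.
move=> oq.
have -> : \sum_(0 <= m < q) sgnz (u m) =
    (q%:Z - 2 * (\sum_(0 <= m < q) (odd `|u m| : nat))%N%:Z)%:~R.
  rewrite intrB intrM int2 -!pmulrn natr_sum mulr_sumr.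
  have -> : q%:R = \sum_(0 <= m < q) 1 :> R by rewrite big_const_nat subn0 iter_addr_0.
  rewrite -sumrB; apply: eq_bigr => m _; rewrite /sgnz.
  by case: (odd _); rewrite /= ?expr1 ?expr0; lra.
rewrite -intr_norm -[1]/(1%:~R) ler_int; lia.
Qed.

Lemma sum_periodic (u : nat -> R) q J : (forall m, u (m + q)%N = u m) ->
  \sum_(0 <= m < J * q) u m = J%:R * \sum_(0 <= m < q) u m.
Proof.
move=> up; elim: J => [|J IH]; first by rewrite mul0n big_geq // mul0r.
rewrite mulSn (@big_cat_nat _ _ _ q) ?leq_addr //= -natr1 mulrDl mul1r addrC -IH.
congr (_ + _); rewrite -{1}[q]add0n big_addn addKn.
by apply: eq_bigr => m _; rewrite up.
Qed.

(** When the integer part of 2 q (x + m theta) - 2 m p does not depend on m, the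
    sign at time m is the one seen by the rational rotation by p/q, hence it is
    q-periodic in m. *)
Lemma discr_sum_block theta x p q J (e : int) : (0 < q)%N ->
  (forall m, (m < J * q)%N ->
     e%:~R <= 2 * (q%:R * x + m%:R * (q%:R * theta - p%:R)) < (e + 1)%:~R) ->
  discr_sum theta x (J * q) =
  J%:R * \sum_(0 <= m < q) sgnz ((e + 2 * m%:Z * p%:Z) %/ q%:Z)%Z.
Proof.
move=> q0 H; rewrite -sum_periodic.
  rewrite /discr_sum [LHS]big_nat [RHS]big_nat; apply: eq_bigr => m /andP[_ mJ].
  apply: half_sign_frac_div => //.
  have := H m mJ; rewrite !intrD !intrM int2 -!pmulrn => /andP[h1 h2].
  by apply/andP; split; lra.
move=> m; rewrite /sgnz; congr (_ ^+ _).
have -> : e + 2 * (m + q)%N%:Z * p%:Z = e + 2 * m%:Z * p%:Z + (2 * p%:Z) * q%:Z by lia.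
rewrite addrC divzMDl; last by lia.
by congr nat_of_bool; lia.
Qed.

(** In units of 1/(2q), the points x + m theta drift by less than one unit
    during the first 2 J q steps, relatively to the rotation by p/q.  Because the drift
    is monotone, it crosses the grid at most once, hence not during the first
    J q steps or not during the following J q steps.  On the undisturbed half
    the sum is J times a sum of q signs, which is nonzero because q is odd. *)
Lemma rho_ge theta x p q J N : odd q ->
  4 * J%:R * q%:R * `|q%:R * theta - p%:R| < 1 -> (2 * J * q <= N)%N ->
  J%:R <= rho theta x N.
Proof.
move=> oq; set d := q%:R * theta - p%:R => hd hN.
have q0 : (0 < q)%N by case: (q) oq.
have [->|J0] := posnP J; first exact: le_trans (rho_ge1 _ _ _).
have Jq0 : (0 < J * q)%N by rewrite muln_gt0 J0.
pose M := (J * q)%N; pose w m := 2 * (q%:R * x + m%:R * d).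
have wfl m := floor_itv (w m).
have q0r : 0 <= q%:R :> R by exact: ler0n.
have key y e : (forall m, (m < M)%N ->
    e%:~R <= 2 * (q%:R * y + m%:R * d) < (e + 1)%:~R) ->
    J%:R <= `|discr_sum theta y M|.
  move=> H; rewrite (@discr_sum_block theta y p q J e) //.
  by rewrite normrM normr_nat ler_peMr ?sgnz_sum_odd.
have Mr : M%:R = J%:R * q%:R :> R by rewrite natrM.
have drift m n : (m <= n <= 2 * M)%N -> `|w n - w m| < 1.
  move=> /andP[mn n2].
  have -> : w n - w m = 2 * (n - m)%:R * d by rewrite /w natrB //; ring.
  rewrite normrM ger0_norm; last by rewrite mulr_ge0.
  apply: le_lt_trans hd; rewrite ler_wpM2r //.
  have : (n - m)%:R <= 2 * M%:R :> R by rewrite -natrM ler_nat; lia.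
  by rewrite Mr; lra.
have fl_mono m n k : (m <= n <= k)%N ->
   (k <= 2 * M)%N -> Num.floor (w m) = Num.floor (w k) ->
   Num.floor (w n) = Num.floor (w m).
  move=> /andP[mn nk] k2 E.
  have [d0|d0] := leP 0 d.
  - apply/eqP; rewrite eq_le; apply/andP; split.
      rewrite E; apply: le_floor; rewrite /w.
      have : n%:R * d <= k%:R * d by apply: ler_wpM2r => //; rewrite ler_nat.
      lra.
    apply: le_floor; rewrite /w.
    have : m%:R * d <= n%:R * d by apply: ler_wpM2r => //; rewrite ler_nat.
    by lra.
  - apply/eqP; rewrite eq_le; apply/andP; split.
      apply: le_floor; rewrite /w.
      have : n%:R * d <= m%:R * d by apply: ler_wnM2r; rewrite ?ler_nat ?(ltW d0).
      lra.
    rewrite E; apply: le_floor; rewrite /w.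
    have : k%:R * d <= n%:R * d by apply: ler_wnM2r; rewrite ?ler_nat ?(ltW d0).
    by lra.
have [E|E] := eqVneq (Num.floor (w 0%N)) (Num.floor (w M)).
  have h : J%:R <= `|discr_sum theta x M|.
    apply: (key x (Num.floor (w 0%N))) => m mM.
    by rewrite -(@fl_mono 0%N m M) ?(ltnW mM) //; lia.
  have := @rho_ge_diff _ theta x N M 1%N; rewrite Jq0 /=.
  have -> : (M <= N)%N by rewrite /M; lia.
  have -> : (0 < N)%N by lia.
  move=> /(_ isT isT).
  have := discr_sum_norm theta x 1.
  have := ler_normB (discr_sum theta x M - discr_sum theta x 1) (- discr_sum theta x 1).
  by rewrite opprK subrK normrN; lra.
have E2 : Num.floor (w M) = Num.floor (w (2 * M)%N).
  have D1 : `|w M - w 0%N| < 1 by apply: drift; lia.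
  have D2 : `|w (2 * M)%N - w M| < 1 by apply: drift; lia.
  have D3 : `|w (2 * M)%N - w 0%N| < 1 by apply: drift; lia.
  have W0 := wfl 0%N; have W1 := wfl M; have W2 := wfl (2 * M)%N.
  have W3 : w (2 * M)%N - w M = w M - w 0%N by rewrite /w natrM; ring.
  move: E W0 W1 W2; set a := Num.floor _; set b := Num.floor _; set c := Num.floor _.
  move=> ab /andP[a1 a2] /andP[b1 b2] /andP[c1 c2].
  move: D1 D2 D3; rewrite !ltr_norml => /andP[? ?] /andP[? ?] /andP[? ?].
  rewrite !intrD in a2 b2 c2.
  have P1 u v : u%:~R < v%:~R + 1 :> R -> u <= v.
    by rewrite -[X in _ + X]/(1%:~R) -intrD ltr_int ltzD1.
  have [d0|d0] := leP (w 0%N) (w M).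
  - have ab1 : a <= b by apply: P1; lra.
    have bc : b <= c by apply: P1; lra.
    have ca : c <= a + 1 by apply: P1; rewrite intrD; lra.
    exact: int_adjacent ab1 bc ca ab.
  - have ba : b <= a by apply: P1; lra.
    have cb : c <= b by apply: P1; lra.
    have ac : a <= c + 1 by apply: P1; rewrite intrD; lra.
    have [//|bc] := eqVneq b c; move: ab; rewrite eq_sym in bc.
    by rewrite (int_adjacent cb ba ac bc) eqxx.
have h : J%:R <= `|discr_sum theta (x + M%:R * theta) M|.
  apply: (key _ (Num.floor (w M) + 2 * (J * q * p)%N%:Z)) => m mM.
  have := wfl (M + m)%N; rewrite (@fl_mono M (M + m)%N (2 * M)%N) //; last by lia.
  rewrite /w !natrD !intrD intrM int2 -!pmulrn !natrM /d => /andP[? ?].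
  by apply/andP; split; lra.
have := @rho_ge_diff _ theta x N (M + M)%N M; rewrite addn_gt0 Jq0 /=.
have -> : (M <= N)%N by rewrite /M; lia.
have -> : (M + M <= N)%N by rewrite /M; lia.
move=> /(_ isT isT); rewrite discr_sumD [_ + discr_sum _ (_ + _) _]addrC addrK; lra.
Qed.

End Lower.

(** * Upper bound from rational approximations *)

Section Upper.
Variable R : realType.
Implicit Types (theta x y : R) (i j n p q : nat).

(** The sign of a point of [c/q, (c+1)/q[, with value 0 when this interval
    contains 1/2 in its interior; this choice makes it odd under the symmetry
    c |-> q - 1 - c. *)
Let sgn_half q c : R := ((2 * c + 1 < q)%N)%:R - ((q < 2 * c + 1)%N)%:R.

Let sum_sgn_half q : \sum_(c < q) sgn_half q c = 0.
Proof.
suff e : \sum_(c < q) sgn_half q c = - \sum_(c < q) sgn_half q c by lra.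
rewrite {1}(reindex_inj rev_ord_inj) -sumrN; apply: eq_bigr => c _ /=.
rewrite /sgn_half; have := ltn_ord c => cq.
have -> : (2 * (q - c.+1) + 1 < q)%N = (q < 2 * c + 1)%N by lia.
have -> : (q < 2 * (q - c.+1) + 1)%N = (2 * c + 1 < q)%N by lia.
by rewrite opprB.
Qed.

(** The intervals [c/q, (c+1)/q[ from which a displacement by less than 1/q can
    reach one of the two discontinuities 0 and 1/2. *)
Let exceptional q : seq nat := [:: 0; q.-1; (q %/ 2).-1; q %/ 2; q.+1 %/ 2]%N.

Let card_exceptional q (s : seq nat) :
  \sum_(c < q) ((nat_of_ord c \in s)%:R : R) <= (size s)%:R.
Proof.
elim: s => [|a s IH]; first by rewrite big1.
rewrite /= -natr1 addrC; apply: le_trans (lerD (lexx _) IH).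
apply: (@le_trans _ _ (\sum_(c < q) ((nat_of_ord c == a)%:R + (nat_of_ord c \in s)%:R))).
  by apply: ler_sum => c _; rewrite inE; case: eqP; case: (_ \in s) => _ //=; lra.
rewrite big_split /= lerD2r.
have [aq|aq] := ltnP a q; last first.
  by rewrite big1 ?ler01 // => c _; have := ltn_ord c; case: eqP => // ->; lia.
rewrite (bigD1 (Ordinal aq)) //= eqxx big1 ?addr0 // => c /eqP ne.
by case: eqP => // e; case: ne; apply: val_inj.
Qed.

Let half_sign_near q y (c : nat) (t : int) : (0 < q)%N -> (c < q)%N ->
  c%:R - 1 < q%:R * (y - t%:~R) < c%:R + 2 ->
  `|half_sign (frac_part y) - sgn_half q c| <= 2 * (c \in exceptional q)%:R.
Proof.
move=> q0 cq /andP[h1 h2].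
have q0r : 0 < q%:R :> R by rewrite ltr0n.
have int2 : (2 : int)%:~R = 2 :> R by [].
have [|ex] := boolP (c \in exceptional q).
  rewrite mulr1 => _; apply: le_trans (ler_normB _ _) _.
  rewrite half_sign_frac_norm -[2]/(1 + 1) lerD2l /sgn_half.
  by case: ltngtP => _; rewrite ?subr0 ?sub0r ?normrN ?normr1 ?normr0 ?ler01.
rewrite mulr0; move: ex; rewrite !inE !negb_or.
case/and5P => e1 e2 e3 e4 e5; have [lo|hi] := leqP (2 * c + 4) q.
- have c1 : 1 <= c%:R :> R by rewrite ler1n; lia.
  have c2 : 2 * c%:R + 4 <= q%:R :> R by rewrite -!(natrM, natrD) ler_nat.
  rewrite (@half_sign_frac _ y (2 * t)).
    rewrite /sgn_half.
    have -> : (2 * c + 1 < q)%N by lia.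
    have -> : (q < 2 * c + 1)%N = false by lia.
    have -> : odd `|2 * t| = false by lia.
    by rewrite expr0 subr0 subrr normr0.
  rewrite intrD intrM int2; apply/andP; split.
    by rewrite -(ler_pM2l q0r); lra.
  by rewrite -(ltr_pM2l q0r); lra.
- have c1 : c%:R + 2 <= q%:R :> R by rewrite -natrD ler_nat; lia.
  have c2 : q%:R + 2 <= 2 * c%:R :> R by rewrite -!(natrM, natrD) ler_nat; lia.
  rewrite (@half_sign_frac _ y (2 * t + 1)).
    rewrite /sgn_half.
    have -> : (2 * c + 1 < q)%N = false by lia.
    have -> : (q < 2 * c + 1)%N by lia.
    have -> : odd `|2 * t + 1| by lia.
    by rewrite expr1 sub0r subrr normr0.
  rewrite !intrD intrM int2; apply/andP; split.
    by rewrite -(ler_pM2l q0r); lra.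
  by rewrite -(ltr_pM2l q0r); lra.
Qed.

(** The Denjoy-Koksma inequality for the half sign.  The residues of
    floor(q x) + j p modulo q, for j < q, are a permutation of 0, ..., q - 1, and
    x + j theta stays within 1/q of the corresponding point of the rational
    rotation.  The signs of the latter sum to zero by symmetry, and at most five
    of them can be wrong, each by at most 2. *)
Lemma denjoy_koksma theta x p q : (0 < q)%N -> coprime p q ->
  `|q%:R * theta - p%:R| * q%:R <= 1 -> `|discr_sum theta x q| <= 10.
Proof.
move=> q0 cpq; set d := q%:R * theta - p%:R => hd.
have q0r : 0 < q%:R :> R by rewrite ltr0n.
have qz : q%:Z != 0 by lia.
set m := Num.floor (q%:R * x).
pose m0 := `|(m %% q%:Z)%Z|%N.
have em : m = (m %/ q%:Z)%Z * q%:Z + m0%:Z.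
  by rewrite {1}(divz_eq m q%:Z) /m0; have := modz_ge0 m qz; lia.
have lt_c (j : 'I_q) : ((m0 + j * p) %% q < q)%N by rewrite ltn_mod.
pose c (j : 'I_q) := Ordinal (lt_c j).
have c_inj : injective c.
  move=> i j /(congr1 val) /= /eqP; rewrite eqn_modDl => e; apply: val_inj => /=.
  wlog ij : i j e / (i <= j)%N.
    by move=> H; case: (leqP i j) => [|/ltnW] ij; [apply: H | apply/esym/H; rewrite // eq_sym].
  move: e; rewrite eq_sym eqn_mod_dvd ?leq_mul2r ?ij ?orbT // -mulnBl Gauss_dvdl 1?coprime_sym //.
  have := ltn_ord j => jq; case: (posnP (j - i)) => [|ji]; first by lia.
  by move/(dvdn_leq ji); lia.
have near_c (j : 'I_q) : `|half_sign (frac_part (x + j%:R * theta)) - sgn_half q (c j)|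
    <= 2 * (nat_of_ord (c j) \in exceptional q)%:R.
  pose t : int := (m %/ q%:Z)%Z + ((m0 + j * p) %/ q)%N%:Z.
  apply: (@half_sign_near q _ (c j) t) => //=.
  have jd : `|j%:R * d| < 1.
    rewrite normrM normr_nat -(ltr_pM2r q0r) mul1r -mulrA.
    apply: (@le_lt_trans _ _ (j%:R * 1)); first by rewrite ler_wpM2l.
    by rewrite mulr1 ltr_nat.
  have e2 : (m + (j * p)%N%:Z) = ((m0 + j * p) %% q)%N%:Z + q%:Z * t.
    rewrite /t {1}em; have := divn_eq (m0 + j * p) q.
    move: ((m0 + j * p) %% q)%N ((m0 + j * p) %/ q)%N (m %/ q%:Z)%Z => r u v; nia.
  clearbody t.
  have : (m + (j * p)%N%:Z)%:~R = (((m0 + j * p) %% q)%N%:Z + q%:Z * t)%:~R :> R.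
    by rewrite e2.
  rewrite !intrD intrM -!pmulrn !natrM => e3.
  have := floor_itv (q%:R * x); rewrite -/m intrD => /andP[f1 f2].
  move: jd; rewrite ltr_norml /d => /andP[d1 d2].
  by apply/andP; split; lra.
rewrite /discr_sum big_mkord.
have -> : \sum_(j < q) half_sign (frac_part (x + j%:R * theta)) =
    \sum_(j < q) (half_sign (frac_part (x + j%:R * theta)) - sgn_half q (c j)).
  have e0 : \sum_(j < q) sgn_half q (c j) = 0.
    by rewrite -[RHS](sum_sgn_half q) [RHS](reindex_inj c_inj).
  by rewrite [RHS]sumrB e0 subr0.
apply: le_trans (ler_norm_sum _ _ _) _.
have count_c : \sum_(j < q) ((nat_of_ord (c j) \in exceptional q)%:R : R) =
    \sum_(i < q) (nat_of_ord i \in exceptional q)%:R.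
  by rewrite [RHS](reindex_inj c_inj).
apply: (@le_trans _ _ (\sum_(j < q) 2 * (nat_of_ord (c j) \in exceptional q)%:R)).
  by apply: ler_sum => j _; exact: near_c.
rewrite -mulr_sumr count_c.
have := card_exceptional q (exceptional q); rewrite [size _]/=.
lra.
Qed.

Lemma discr_sum_mul_le theta x q b (B : R) :
  (forall y, `|discr_sum theta y q| <= B) -> `|discr_sum theta x (b * q)| <= b%:R * B.
Proof.
move=> H; elim: b => [|b IH] in x *.
  by rewrite mul0n mul0r /discr_sum big_geq // normr0.
rewrite mulSn discr_sumD; apply: le_trans (ler_normD _ _) _.
by rewrite -natr1 mulrDl mul1r addrC; apply: lerD.
Qed.

(** A sum of length N < 2^(j+1) consists of N %/ q blocks of length
    q <= 2^j, each bounded by 10, and of a remainder of length less than q,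
    to which the bound at level j applies.  So each doubling of the length
    costs at most 20 b j. *)
Lemma discr_sum_dyadic theta (b : nat -> R) j0 :
  (forall j, (j0 <= j)%N -> exists p q, [/\ (0 < q <= 2 ^ j)%N, coprime p q,
     `|q%:R * theta - p%:R| * (2 ^ j)%:R <= 1 & (2 ^ j)%:R / q%:R <= b j]) ->
  forall j x N, (j0 <= j)%N -> (N < 2 ^ j)%N ->
    `|discr_sum theta x N| <= (2 ^ j0)%:R + 20 * \sum_(j0 <= i < j) b i.
Proof.
move=> H j; elim: j => [|j IH] x N.
  rewrite leqn0 => /eqP -> N1; rewrite big_geq // mulr0 addr0.
  by apply: le_trans (discr_sum_norm _ _ _) _; rewrite ler_nat; lia.
rewrite leq_eqVlt => /orP[/eqP e|]; first rewrite e => N1.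
  by rewrite big_geq // mulr0 addr0; apply: le_trans (discr_sum_norm _ _ _) _; rewrite ler_nat; lia.
rewrite ltnS => jj N1; have [p [q [/andP[q0 qj] cpq hd hb]]] := H j jj.
have q0r : 0 < q%:R :> R by rewrite ltr0n.
have DK y : `|discr_sum theta y q| <= 10.
  apply: denjoy_koksma cpq _ => //; apply: le_trans hd.
  by apply: ler_wpM2l => //; rewrite ler_nat.
rewrite (divn_eq N q) discr_sumD; apply: le_trans (ler_normD _ _) _.
have h1 := discr_sum_mul_le x (N %/ q) DK.
have r_lt : (N %% q < 2 ^ j)%N by apply: leq_trans qj; rewrite ltn_mod.
have h2 := IH (x + (N %/ q * q)%N%:R * theta) (N %% q)%N jj r_lt.
have h3 : (N %/ q)%:R <= 2 * b j.
  apply: le_trans (_ : 2 * ((2 ^ j)%:R / q%:R) <= _); last by rewrite ler_pM2l.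
  rewrite mulrA ler_pdivlMr // -!natrM ler_nat.
  by apply: leq_trans (leq_divM _ _) _; rewrite -expnS ltnW.
by rewrite big_nat_recr //= mulrDr; lra.
Qed.

End Upper.

(** * Continued fraction cylinders and their measure *)

Section ContinuedFractions.
Variable R : realType.
Implicit Types (theta : R) (a k d n : nat).
Local Notation mu := (@lebesgue_measure R).

(** The last two convergents cnum/cden and pnum/pden of a finite continued
    fraction, the first of the two being the more recent one. *)
Record convergents := Convergents { cnum : nat; cden : nat; pnum : nat; pden : nat }.
Implicit Type s : convergents.

Definition next_convergents s a :=
  Convergents (a * cnum s + pnum s) (a * cden s + pden s) (cnum s) (cden s).

(** The convergents 0/1 and 1/0 of the empty expansion. *)
Definition unit_interval := Convergents 0 1 1 0.

Definition valid s := [/\ (0 < cden s)%N, (pden s <= cden s)%N &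
  (cnum s * pden s = pnum s * cden s + 1)%N \/ (pnum s * cden s = cnum s * pden s + 1)%N].

Definition cerr s theta : R := (cden s)%:R * theta - (cnum s)%:R.
Definition perr s theta : R := (pden s)%:R * theta - (pnum s)%:R.

(** For an irrational number of ]0, 1[, to have an expansion that starts with the
    given digits is to lie strictly between cnum/cden and the mediant of the
    two convergents; the sign of a product does not depend on which of these
    two endpoints is the larger one. *)
Definition cylinder s : set R :=
  [set theta | cerr s theta * (cerr s theta + perr s theta) < 0].

Definition cyl_len s : R := ((cden s)%:R * (cden s + pden s)%:R)^-1.

Lemma valid_unit_interval : valid unit_interval.
Proof. by split=> //; right. Qed.

Lemma valid_next s a : (0 < a)%N -> valid s -> valid (next_convergents s a).
Proof. by case: s => p q p' q' a0 [/= q0 qq det]; split=> /=; [nia | nia | nia]. Qed.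

Lemma valid_coprime s : valid s -> coprime (cnum s) (cden s).
Proof.
case: s => p q p' q' [/= q0 _ det]; rewrite /coprime -dvdn1.
have := dvdn_gcdl p q; have := dvdn_gcdr p q; move: (gcdn p q) => g gq gp.
have [a ea] := dvdnP gp; have [b eb] := dvdnP gq; subst.
apply/dvdnP; case: det => det; [exists (a * q' - p' * b)%N | exists (p' * b - a * q')%N]; nia.
Qed.

Lemma cerr_next s a theta :
  cerr (next_convergents s a) theta = a%:R * cerr s theta + perr s theta.
Proof. by rewrite /cerr /perr /= !natrD !natrM; ring. Qed.

Lemma cyl_len_gt0 s : valid s -> 0 < cyl_len s.
Proof. by case=> q0 _ _; rewrite invr_gt0 -natrM ltr0n; nia. Qed.

Lemma mulf_lt0_between (t u v : R) :
  ((t - u) * (t - v) < 0) = (Num.min u v < t < Num.max u v).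
Proof.
rewrite gt_min lt_max; case: (ltgtP u t) => h1; case: (ltgtP v t) => h2 /=.
all: rewrite ?h1 ?h2 ?subrr ?mulr0 ?mul0r ?ltxx //.
- by apply/negbTE; rewrite -leNgt mulr_ge0 // subr_ge0 ltW.
- by rewrite pmulr_rlt0 ?subr_gt0 // subr_lt0.
- by rewrite nmulr_rlt0 ?subr_lt0 // subr_gt0.
- by apply/negbTE; rewrite -leNgt mulr_le0 // subr_le0 ltW.
Qed.

Lemma cylinderE s : valid s ->
  let u : R := (cnum s)%:R / (cden s)%:R in
  let v : R := (cnum s + pnum s)%:R / (cden s + pden s)%:R in
  cylinder s = `]Num.min u v, Num.max u v[%classic /\ `|u - v| = cyl_len s.
Proof.
move=> vs u v; case: (vs) => q0 _ det; split; last first.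
  have q0r : 0 < (cden s)%:R :> R by rewrite ltr0n.
  have qq0r : 0 < (cden s + pden s)%:R :> R by rewrite ltr0n; lia.
  have -> : u - v = ((cnum s * pden s)%:R - (pnum s * cden s)%:R) * cyl_len s.
    rewrite /u /v /cyl_len !natrD !natrM; field.
    by rewrite -natrD !gt_eqF.
  rewrite normrM (gtr0_norm (cyl_len_gt0 vs)); case: det => ->; rewrite natrD.
    by rewrite addrAC subrr add0r normr1 mul1r.
  by rewrite opprD addrA subrr add0r normrN normr1 mul1r.
have q0r : 0 < (cden s)%:R :> R by rewrite ltr0n.
have qq0r : 0 < (cden s + pden s)%:R :> R by rewrite ltr0n; lia.
apply/seteqP; split => theta; rewrite /cylinder /= in_itv /=;
  have -> : cerr s theta = (cden s)%:R * (theta - u)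
    by rewrite /cerr /u; field; rewrite gt_eqF.
all: have -> : (cden s)%:R * (theta - u) + perr s theta =
       (cden s + pden s)%:R * (theta - v)
    by rewrite /perr /u /v !natrD; field; rewrite -natrD !gt_eqF.
all: rewrite mulrACA (pmulr_rlt0 _ (mulr_gt0 q0r qq0r)).
all: by rewrite mulf_lt0_between.
Qed.

Lemma measurable_cylinder s : valid s -> measurable (cylinder s).
Proof. by move=> /cylinderE[-> _]. Qed.

Lemma cylinder_measure s : valid s -> mu (cylinder s) = (cyl_len s)%:E.
Proof.
move=> vs; have [-> <-] := cylinderE vs; rewrite lebesgue_measure_itv /= lte_fin.
have q0 := cyl_len_gt0 vs; move: q0; have [_ <-] := cylinderE vs.
set u := _ / _; set v := _ / _; rewrite normr_gt0 subr_eq0 => uv.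
case: (ltgtP u v) => uv'.
- by rewrite -EFinB uv' ltr0_norm ?subr_lt0 // opprB.
- by rewrite -EFinB uv' gtr0_norm ?subr_gt0.
- by rewrite uv' eqxx in uv.
Qed.

Section Tree.
Variables (ok : nat -> convergents -> nat -> bool) (fin : convergents -> bool).

(** The union of the cylinders reached from s after d more digits that are all
    allowed by ok and that lead to convergents satisfying fin; k counts the
    digits already read, so that ok may depend on the position. *)
Fixpoint tree d k s : set R :=
  if d is d'.+1 then
    \bigcup_(a in [set a | (0 < a)%N && ok k s a]) tree d' k.+1 (next_convergents s a)
  else if fin s then cylinder s else set0.

Lemma measurable_tree d k s : valid s -> measurable (tree d k s).
Proof.
elim: d k s => [|d IH] k s vs /=; first by case: ifP => // _; exact: measurable_cylinder.
apply: bigcup_measurable => a /= /andP[a0 _].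
by apply: IH; exact: valid_next.
Qed.

Variable Phi : nat -> nat -> convergents -> R.
Hypothesis Phi_ge0 : forall d k s, valid s -> 0 <= Phi d k s.
Hypothesis Phi0 : forall k s, valid s -> fin s -> cyl_len s <= Phi 0 k s.
Hypothesis PhiS : forall d k s n, valid s ->
  \sum_(1 <= a < n.+1 | ok k s a) Phi d k.+1 (next_convergents s a) <= Phi d.+1 k s.

(** A potential that dominates the lengths at the leaves and that is
    superadditive along the allowed branches bounds the measure of the tree.
    Both metric results on digits below are obtained by a choice of Phi. *)
Lemma tree_measure d k s : valid s -> (mu (tree d k s) <= (Phi d k s)%:E)%E.
Proof.
elim: d k s => [|d IH] k s vs.
  rewrite /=; case: ifP => f; last by rewrite measure0 lee_fin Phi_ge0.
  by rewrite cylinder_measure // lee_fin Phi0.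
pose F a := if ok k s a.+1 then tree d k.+1 (next_convergents s a.+1) else set0.
have mF a : measurable (F a).
  rewrite /F; case: ifP => // _; apply: measurable_tree; exact: valid_next.
have sub : tree d.+1 k s `<=` \bigcup_a F a.
  by move=> theta [[|a] //= oka ta]; exists a => //; rewrite /F oka.
apply: le_trans (measure_sigma_subadditive mu mF (measurable_tree _ _ vs) sub) _.
apply: lime_le; first by apply: is_cvg_nneseries => a _ _.
apply: nearW => n /=; apply: le_trans (_ : (\sum_(0 <= a < n | ok k s a.+1)
    (Phi d k.+1 (next_convergents s a.+1))%:E <= _)%E).
  rewrite [leRHS]big_mkcond; apply: lee_sum => a _; rewrite /F.
  by case: ifP => _; [apply: IH; exact: valid_next | rewrite measure0].
rewrite sumEFin lee_fin; apply: le_trans (PhiS d k n vs).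
by rewrite big_add1.
Qed.

End Tree.
End ContinuedFractions.

(** * Expansion of a number and quality of its convergents *)

Section Paths.
Variable R : realType.
Implicit Types (theta : R) (a k d n : nat) (s : convergents).

(** On a cylinder, cerr and perr have opposite signs and the new error
    a * cerr + perr keeps the sign of perr for all a up to this value; this is
    the next partial quotient of theta. *)
Definition digit theta s := Num.truncn (- (perr s theta / cerr s theta)).
Definition descend theta s := next_convergents s (digit theta s).
Definition expansion theta k s := iter k (descend theta) s.

Lemma cerr_neq0 theta s : irrational theta -> (0 < cden s)%N -> cerr s theta != 0.
Proof.
move=> irr q0; apply/negP => /eqP e; apply: irr.
exists ((cnum s)%:R / (cden s)%:R : rat) => //.
rewrite fmorph_div !rmorph_nat.
have q0r : (cden s)%:R != 0 :> R by rewrite pnatr_eq0 -lt0n.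
by apply: (mulfI q0r); rewrite mulrCA divff // mulr1; move: e; rewrite /cerr; lra.
Qed.

Lemma descend_in_cylinder theta s : irrational theta -> valid s -> cylinder s theta ->
  [/\ (0 < digit theta s)%N, valid (descend theta s) & cylinder (descend theta s) theta].
Proof.
move=> irr vs cs; have [q0 _ _] := vs.
have e0 := cerr_neq0 irr q0.
set t := - (perr s theta / cerr s theta).
have et : perr s theta = - t * cerr s theta by rewrite /t opprK divfK.
have e2 : 0 < cerr s theta ^+ 2 by rewrite exprn_even_gt0.
have t1 : 1 < t.
  move: cs; rewrite /cylinder /= et => cs.
  rewrite -subr_gt0 -(pmulr_rgt0 _ e2); move: cs; rewrite expr2; lra.
have a0 : (0 < digit theta s)%N by rewrite /digit truncn_gt0 ltW.
have vn : valid (descend theta s) by exact: valid_next.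
split=> //.
have qn0 : (0 < cden (descend theta s))%N by case: vn.
have en0 := cerr_neq0 irr qn0.
have t0 : 0 <= t by lra.
have /andP[ta ta1] := truncn_itv t0.
move: en0; rewrite /cylinder /= /descend !cerr_next -/(digit theta s).
have -> : perr (next_convergents s (digit theta s)) theta = cerr s theta by [].
rewrite et -mulrDl mulf_eq0 negb_or => /andP[en0 _].
have at0 : (digit theta s)%:R + - t < 0 by rewrite lt_neqAle en0 subr_le0.
have at1 : 0 < (digit theta s)%:R + 1 - t by rewrite subr_gt0 natr1.
rewrite -[X in _ * (_ + X)]mul1r -mulrDl mulrACA -expr2 pmulr_llt0 //.
by rewrite nmulr_rlt0 //; lra.
Qed.

Lemma expansion_valid theta s k : irrational theta -> valid s -> cylinder s theta ->
  valid (expansion theta k s) /\ cylinder (expansion theta k s) theta.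
Proof.
move=> irr vs cs; elim: k => [|k [vk ck]] //=.
by have [_ ? ?] := descend_in_cylinder irr vk ck.
Qed.

Lemma expansion_in_tree theta (ok : nat -> convergents -> nat -> bool) (fin : convergents -> bool) d k s : irrational theta -> valid s -> cylinder s theta ->
  (forall i, (i < d)%N -> ok (k + i)%N (expansion theta i s) (digit theta (expansion theta i s))) ->
  fin (expansion theta d s) -> tree ok fin d k s theta.
Proof.
move=> irr; elim: d k s => [|d IH] k s vs cs hok hfin /=; first by rewrite hfin.
have [a0 vn cn] := descend_in_cylinder irr vs cs.
exists (digit theta s) => /=; first by rewrite a0 /=; have := hok 0%N isT; rewrite addn0.
apply: IH => //; last by move: hfin; rewrite /expansion iterSr.
by move=> i id; have := hok i.+1 id; rewrite /expansion iterSr addnS.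
Qed.

(** Expansions of a given length range over countably many convergents, one for
    each word of digits. *)
Lemma expansion_foldl theta s k :
  expansion theta k s = foldl next_convergents s [seq digit theta (expansion theta i s) | i <- iota 0 k].
Proof.
elim: k => // k IH; rewrite -{2}addn1 iotaD map_cat foldl_cat -IH /=.
by rewrite add0n.
Qed.

Lemma natr_dist1 m n : m = (n + 1)%N \/ n = (m + 1)%N -> `|m%:R - n%:R| = 1 :> R.
Proof.
case=> ->; rewrite natrD; last by rewrite opprD addrA subrr add0r normrN normr1.
by rewrite addrAC subrr add0r normr1.
Qed.

(** The determinant identity says that the errors of two consecutive
    convergents, each multiplied by the other denominator, differ by 1 in
    absolute value, and they have opposite signs. *)
Lemma cerr_lt theta s : irrational theta -> valid s -> cylinder s theta ->
  `|cerr s theta| * (cden (descend theta s))%:R < 1.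
Proof.
move=> irr vs cs; have [q0 _ det] := vs; have [a0 vn cn] := descend_in_cylinder irr vs cs.
have [qn0 _ _] := vn.
have en0 := cerr_neq0 irr qn0; have e0 := cerr_neq0 irr q0.
set a := digit theta s in a0 *; rewrite /descend -/a in vn cn qn0 en0 *.
set s' := next_convergents s a in vn cn qn0 en0 *.
have pe : perr s' theta = cerr s theta by [].
have opp : cerr s' theta * cerr s theta < 0.
  move: cn; rewrite /cylinder /= pe mulrDr => h.
  have : 0 < cerr s' theta * cerr s' theta by rewrite -expr2 exprn_even_gt0.
  by lra.
have det' : `|(cden s')%:R * cerr s theta - (cden s)%:R * cerr s' theta| = 1.
  have -> : (cden s')%:R * cerr s theta - (cden s)%:R * cerr s' theta =
      (cden s * pnum s)%:R - (pden s * cnum s)%:R.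
    by rewrite /cerr /= !natrD !natrM; ring.
  by apply: natr_dist1; rewrite [(_ * pnum s)%N]mulnC [(_ * cnum s)%N]mulnC; case: det; tauto.
have q'r : 0 < (cden s')%:R :> R by rewrite ltr0n.
have qr : 0 < (cden s)%:R :> R by rewrite ltr0n.
rewrite -[X in _ * X]gtr0_norm // -normrM mulrC -[X in _ < X]det'.
have [cp|cn'|/eqP] := ltgtP 0 (cerr s theta); last by rewrite eq_sym (negbTE e0).
- have cn2 : cerr s' theta < 0 by move: opp; rewrite pmulr_llt0.
  have h1 : 0 < (cden s')%:R * cerr s theta by rewrite mulr_gt0.
  have h2 : 0 < - ((cden s)%:R * cerr s' theta) by rewrite oppr_gt0 pmulr_rlt0.
  by rewrite !gtr0_norm; lra.
- have cn2 : 0 < cerr s' theta by move: opp; rewrite nmulr_llt0.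
  have h1 : (cden s')%:R * cerr s theta < 0 by rewrite pmulr_rlt0.
  have h2 : 0 < (cden s)%:R * cerr s' theta by rewrite mulr_gt0.
  by rewrite !ltr0_norm; lra.
Qed.

Lemma cden_expansion_ge theta k : irrational theta -> cylinder unit_interval theta ->
  (k <= cden (expansion theta k unit_interval))%N.
Proof.
move=> irr cs; pose c k := expansion theta k unit_interval.
have vc j := expansion_valid j irr valid_unit_interval cs.
case: k => // k; elim: k => [|k IH].
  by have [[]] := vc 1%N.
have [[q0 _ _] _] := vc k; have [vk1 ck1] := vc k.+1.
have [a0 _ _] := descend_in_cylinder irr vk1 ck1.
have -> : cden (expansion theta k.+2 unit_interval) =
  (digit theta (expansion theta k.+1 unit_interval) * cden (expansion theta k.+1 unit_interval)
   + cden (expansion theta k unit_interval))%N by [].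
move: IH q0 a0; move: (cden _) (cden _) (digit _ _) => u v a; nia.
Qed.

Lemma cylinder_unit_interval theta : 0 < theta < 1 -> cylinder unit_interval theta.
Proof.
move=> /andP[t0 t1]; rewrite /cylinder /cerr /perr /=.
by rewrite mul1r mul0r subr0 sub0r pmulr_rlt0 // subr_lt0.
Qed.

(** Dirichlet's approximation theorem, with a reduced fraction: take the last
    convergent whose denominator is at most Q. *)
Lemma dirichlet theta Q : irrational theta -> 0 < theta < 1 -> (0 < Q)%N ->
  exists p q, [/\ (0 < q <= Q)%N, coprime p q & `|q%:R * theta - p%:R| * Q%:R < 1].
Proof.
move=> irr t01 Q0; have cs := cylinder_unit_interval t01.
pose c k := expansion theta k unit_interval.
have vc j := expansion_valid j irr valid_unit_interval cs.
have ex : exists k, (Q < cden (c k))%N.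
  by exists Q.+1; exact: cden_expansion_ge.
have := ex_minnP ex; case=> -[|k] hk kmin; first by move: hk => /=; lia.
have [vk ck] := vc k; have [q0 _ _] := vk.
have qQ : (cden (c k) <= Q)%N by rewrite leqNgt; apply/negP => /kmin; rewrite ltnn.
exists (cnum (c k)), (cden (c k)); split; first by rewrite q0.
  exact: valid_coprime.
apply: le_lt_trans (cerr_lt irr vk ck).
by apply: ler_wpM2l => //; rewrite ler_nat ltnW.
Qed.

End Paths.

(** * Growth of the denominators *)

Section MetricEstimates.
Variable R : realType.
Implicit Types (theta : R) (a k d n : nat) (s : convergents).
Local Notation mu := (@lebesgue_measure R).

Lemma borel_cantelli_bounded (F : (set R)^nat) (u : nat -> R) (B : R) :
  (forall n, measurable (F n)) -> (forall n, (mu (F n) <= (u n)%:E)%E) ->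
  (forall n, \sum_(0 <= i < n) u i <= B) -> mu.-negligible (lim_sup_set F).
Proof.
move=> mF Fu uB; apply/negligibleP.
  apply: bigcapT_measurable => n; apply: bigcup_measurable => j _; exact: mF.
apply: lim_sup_set_cvg0 => //; apply: le_lt_trans (ltry B).
apply: lime_le; first by apply: is_cvg_nneseries => n _ _.
apply: nearW => n; apply: (@le_trans _ _ ((\sum_(0 <= i < n) u i)%:E)).
  by rewrite -sumEFin; apply: lee_sum => i _; exact: Fu.
by rewrite lee_fin.
Qed.

Lemma cyl_len_next s a : (0 < a)%N -> valid s ->
  cyl_len R (next_convergents s a) =
  (cden s)%:R^-1 * ((a * cden s + pden s)%:R^-1 - (a.+1 * cden s + pden s)%:R^-1).
Proof.
move=> a0 [q0 _ _]; rewrite /cyl_len /=.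
have h1 : (cden s)%:R != 0 :> R by rewrite pnatr_eq0 -lt0n.
have h2 : (a * cden s + pden s)%:R != 0 :> R by rewrite pnatr_eq0; nia.
have -> : (a.+1 * cden s + pden s = a * cden s + pden s + cden s)%N by lia.
have h3 : (a * cden s + pden s + cden s)%:R != 0 :> R by rewrite pnatr_eq0; nia.
move: h3; rewrite natrD; move: h1 h2; move: (cden s)%:R (_ + _)%:R => u v h1 h2 h3; field.
by rewrite h1 h2 h3.
Qed.

Lemma sum_cyl_len s n : (0 < n)%N -> valid s ->
  \sum_(1 <= a < n) cyl_len R (next_convergents s a) =
  cyl_len R s - ((cden s)%:R * (n * cden s + pden s)%:R)^-1.
Proof.
move=> n0 vs.
rewrite big_nat (eq_bigr (fun a => - (cden s)%:R^-1 *
   ((a.+1 * cden s + pden s)%:R^-1 - (a * cden s + pden s)%:R^-1))); last first.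
  by move=> a /andP[a0 _]; rewrite cyl_len_next // -opprB mulrN mulNr.
rewrite -big_nat -mulr_sumr telescope_sumr // mul1n mulNr -mulrN opprB mulrBr.
by rewrite /cyl_len !invfM.
Qed.

Lemma sum_cyl_len_le s n (P : pred nat) : valid s ->
  \sum_(1 <= a < n.+1 | P a) cyl_len R (next_convergents s a) <= cyl_len R s.
Proof.
move=> vs; apply: (@le_trans _ _ (\sum_(1 <= a < n.+1) cyl_len R (next_convergents s a))).
  rewrite big_mkcond /= big_nat [leRHS]big_nat; apply: ler_sum => a /andP[a0 _].
  by case: ifP => // _; apply/ltW/cyl_len_gt0; exact: valid_next.
by rewrite sum_cyl_len // gerBl invr_ge0 -natrM.
Qed.

(** Within a cylinder, the next digit is at least h with conditional
    probability at least 1/h. *)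
Lemma sum_cyl_len_lt s h n : (0 < h)%N -> valid s ->
  \sum_(1 <= a < n.+1 | (a < h)%N) cyl_len R (next_convergents s a) <=
  (1 - h%:R^-1) * cyl_len R s.
Proof.
move=> h0 vs; have [q0 qq _] := vs.
apply: (@le_trans _ _ (\sum_(1 <= a < h) cyl_len R (next_convergents s a))).
  have pos a : (1 <= a)%N -> 0 <= cyl_len R (next_convergents s a).
    by move=> a0; apply/ltW/cyl_len_gt0; exact: valid_next.
  have [nh|hn] := leqP n.+1 h.
    rewrite [leRHS](@big_cat_nat _ _ _ n.+1) //= -[leLHS]addr0 big_mkcond /=.
    apply: lerD; last by rewrite big_nat sumr_ge0 // => a /andP[na _]; apply: pos; lia.
    rewrite big_nat [leRHS]big_nat; apply: ler_sum => a /andP[a0 an].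
    by case: ifP => // _; exact: pos.
  rewrite (@big_cat_nat _ _ _ h) //=; last by lia.
  rewrite [X in _ + X]big_nat_cond [X in _ + X]big1 ?addr0; last by move=> a; lia.
  by rewrite big_mkcond big_nat [leRHS]big_nat; apply: ler_sum => a /andP[a0 ah]; rewrite ah.
rewrite sum_cyl_len // mulrBl mul1r lerD2l lerN2 /cyl_len -invfM.
rewrite lef_pV2 ?posrE ?mulr_gt0 ?ltr0n //; [|nia..].
by rewrite -!natrM ler_nat; nia.
Qed.

Let sqd n : R := Num.sqrt n%:R.

Let sqd_gt0 n : (0 < n)%N -> 0 < sqd n.
Proof. by move=> n0; rewrite sqrtr_gt0 ltr0n. Qed.

Let sqdK n : sqd n ^+ 2 = n%:R.
Proof. by rewrite sqr_sqrtr. Qed.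

(** The right-hand side telescopes along the arithmetic progression
    u, u + q, u + 2q, ... of the possible next denominators. *)
Lemma sqrt_weight_step (q u : nat) : (0 < q)%N -> (0 < u)%N ->
  sqd u * (u%:R * (u + q)%:R)^-1 <= 2 / q%:R * ((sqd u)^-1 - (sqd (u + q))^-1).
Proof.
move=> q0 u0; have s0 := sqd_gt0 u0.
have t0 : 0 < sqd (u + q) by apply: sqd_gt0; lia.
have eq_ : q%:R = sqd (u + q) ^+ 2 - sqd u ^+ 2 by rewrite !sqdK natrD addrC addKr.
have qr : 0 < q%:R :> R by rewrite ltr0n.
rewrite -(sqdK u) -(sqdK (u + q)) eq_; move: s0 t0 eq_.
set x := sqd u; set y := sqd (u + q) => x0 y0 e.
have xy : x < y by rewrite -(ltr_pXn2r (n := 2)) ?nnegrE ?ltW // -subr_gt0 -e.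
have -> : x * (x ^+ 2 * y ^+ 2)^-1 = (x * y ^+ 2)^-1.
  by field; rewrite !gt_eqF.
have -> : 2 / (y ^+ 2 - x ^+ 2) * (x^-1 - y^-1) = 2 / ((x + y) * (x * y)).
  have h1 : 0 < y ^+ 2 - x ^+ 2 by rewrite -e.
  have h2 : 0 < x + y by lra.
  field. by rewrite !gt_eqF.
have h : 0 < (x + y) * (x * y) by rewrite !mulr_gt0 // addr_gt0.
rewrite ler_pdivlMr // mulrC ler_pdivrMr ?mulr_gt0 ?exprn_gt0 //.
by rewrite expr2; nra.
Qed.

(** On average, the square root of the denominator grows by at most a factor 3
    when a digit is added; the denominator itself has no finite average, since a
    digit exceeds h with probability of order 1/h. *)
Lemma sqrt_weight_sum s n : valid s ->
  \sum_(1 <= a < n.+1) sqd (cden (next_convergents s a)) * cyl_len R (next_convergents s a)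
  <= 3 * (sqd (cden s) * cyl_len R s).
Proof.
move=> vs; have [q0 qq _] := vs; set q := cden s in q0 qq *.
have qr : 0 < q%:R :> R by rewrite ltr0n.
pose v a := (sqd (a * q + pden s))^-1.
apply: (@le_trans _ _ (\sum_(1 <= a < n.+1) (2 / q%:R * (v a - v a.+1)))).
  rewrite big_nat [leRHS]big_nat; apply: ler_sum => a /andP[a0 _].
  rewrite /cyl_len /= -/q /v.
  have -> : (a.+1 * q + pden s = a * q + pden s + q)%N by lia.
  by apply: sqrt_weight_step => //; nia.
rewrite -mulr_sumr (eq_bigr (fun a => - (v a.+1 - v a))); last by move=> a _; rewrite opprB.
rewrite sumrN telescope_sumr // opprB.
have vge a : 0 <= v a by rewrite invr_ge0 sqrtr_ge0.
apply: (@le_trans _ _ (2 / q%:R * v 1%N)).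
  by rewrite ler_wpM2l ?divr_ge0 // gerBl.
rewrite /v mul1n /cyl_len -/q.
have s0 := sqd_gt0 q0.
have t0 : 0 < sqd (q + pden s) by apply: sqd_gt0; lia.
have ts : 2 * sqd (q + pden s) <= 3 * sqd q.
  rewrite -(ler_pXn2r (n := 2)) ?nnegrE ?mulr_ge0 ?sqrtr_ge0 //.
  rewrite !exprMn !sqdK -!natrX -!natrM ler_nat; lia.
rewrite -(sqdK q) -(sqdK (q + pden s)); move: s0 t0 ts.
set x := sqd q; set y := sqd _ => x0 y0 ts.
have -> : 2 / x ^+ 2 / y = (2 * y) / (x ^+ 2 * y ^+ 2) by field; rewrite !gt_eqF.
rewrite mulrA ler_pM2r ?invr_gt0 ?mulr_gt0 ?exprn_gt0 //.
Qed.

(** By Markov's inequality applied to the square root of the denominator, the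
    denominator exceeds 16^k after k digits with probability at most
    3^k / 4^k, which is summable. *)
Lemma cden_growth :
  {ae mu, forall theta, irrational theta -> 0 < theta < 1 ->
    exists K, forall k, (K <= k)%N -> (cden (expansion theta k unit_interval) <= 16 ^ k)%N}.
Proof.
pose fin d s := (16 ^ d < cden s)%N.
pose F d := @tree R (fun _ _ _ => true) (fin d) d 0 unit_interval.
have mF d : (mu (F d) <= ((3 / 4) ^+ d)%:E)%E.
  pose Phi (X : R) d (_ : nat) s := 3 ^+ d * (sqd (cden s) * cyl_len R s) / X.
  have -> : (3 / 4) ^+ d = Phi (4 ^+ d) d 0%N unit_interval.
    rewrite /Phi /cyl_len /sqd /= sqrtr1 expr_div_n.
    by rewrite addn0 mulr1 invr1 !mulr1.
  have X0 : 0 < 4 ^+ d :> R by rewrite exprn_gt0.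
  apply: tree_measure => [d' k s vs|k s vs fs|d' k s n vs|]; last exact: valid_unit_interval.
  - by rewrite /Phi divr_ge0 ?mulr_ge0 ?exprn_ge0 ?sqrtr_ge0 // ltW ?cyl_len_gt0.
  - have le_sqd : 4 ^+ d <= sqd (cden s).
      rewrite -(ler_pXn2r (n := 2)) ?nnegrE ?exprn_ge0 ?sqrtr_ge0 // sqdK.
      by rewrite -!natrX ler_nat -expnM mulnC expnM ltnW.
    rewrite /Phi expr0 mul1r mulrAC ler_peMl ?(ltW (cyl_len_gt0 _ vs)) //.
    by rewrite ler_pdivlMr // mul1r.
  - rewrite /Phi -mulr_suml ler_wpM2r ?invr_ge0 ?(ltW X0) //.
    rewrite -mulr_sumr exprSr -mulrA ler_wpM2l ?exprn_ge0 //.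
    exact: sqrt_weight_sum.
have neg : mu.-negligible (lim_sup_set F).
  apply: (@borel_cantelli_bounded F (fun d => (3 / 4) ^+ d) 4) => // n.
    by apply: measurable_tree; exact: valid_unit_interval.
  suff -> : \sum_(0 <= i < n) (3 / 4) ^+ i = 4 - 4 * (3 / 4) ^+ n :> R.
    by rewrite gerBl mulr_ge0 // exprn_ge0.
  elim: n => [|n IH]; first by rewrite big_geq // expr0; lra.
  by rewrite big_nat_recr //= IH exprS; lra.
apply: negligibleS neg => theta /= /not_implyP[irr] /not_implyP[t01] H n _.
apply: contrapT => nF; apply: H; exists n => k nk; rewrite leqNgt; apply/negP => hk.
apply: nF; exists k => //; apply: expansion_in_tree => //; first exact: valid_unit_interval.
exact: cylinder_unit_interval.
Qed.

End MetricEstimates.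

(** * Large digits after odd denominators *)

Section FrequentLargeDigits.
Variable R : realType.
Implicit Types (theta : R) (a k d n : nat) (s : convergents).
Local Notation mu := (@lebesgue_measure R).

(** An elementary form of the bound of a product of 1 - x i by
    exp (- sum of the x i): it suffices to make the product small when the
    sum diverges. *)
Lemma prod_1B_le (x : nat -> R) m n : (forall i, 0 <= x i <= 1) ->
  0 <= \prod_(m <= i < n) (1 - x i) <= (1 + \sum_(m <= i < n) x i)^-1.
Proof.
move=> x01.
have p0 j : 0 <= \prod_(m <= i < j) (1 - x i).
  by apply: prodr_ge0 => i _; have /andP[_ ?] := x01 i; rewrite subr_ge0.
have s0 j : 0 <= \sum_(m <= i < j) x i.
  by apply: sumr_ge0 => i _; have /andP[] := x01 i.
rewrite p0 /= -[_^-1]mul1r ler_pdivlMr ?ltr_wpDr //.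
have [nm|mn] := leqP n m; first by rewrite !big_geq // addr0 mulr1.
elim: n mn => // n IH; rewrite ltnS leq_eqVlt => /orP[/eqP<-|mn].
  by rewrite !big_nat1; have /andP[? ?] := x01 m; nra.
rewrite !big_nat_recr ?(ltnW mn) //=; have {IH} := IH mn.
have /andP[x0 x1] := x01 n; move: (p0 n) (s0 n).
move: (\prod_(_ <= _ < _) _) (\sum_(_ <= _ < _) _) (x n) x0 x1 => P S t t0 t1 P0 S0 H.
have -> : P * (1 - t) * (1 + (S + t)) = P * (1 + S) - P * (t * S + t ^+ 2) by ring.
by rewrite lerBlDr (le_trans H) // lerDl mulr_ge0 // addr_ge0 ?mulr_ge0 ?exprn_ge0.
Qed.

Variable h : nat -> nat.
Hypothesis h_gt0 : forall k, (0 < h k)%N.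
Hypothesis h_nondecr : {homo h : k n / (k <= n)%N}.

Let x i : R := (2 * (h i)%:R)^-1.

Let x01 i : 0 <= x i <= 1.
Proof.
have h1 : 1 <= (h i)%:R :> R by rewrite ler1n.
rewrite invr_ge0 mulr_ge0 //= invf_le1; lra.
Qed.

Let small_digit k s a := odd (cden s) ==> (a < h k)%N.

(** An even denominator is always followed by an odd one.  So at least one of two
    consecutive positions gives a chance 1/h of a large digit; with the halved
    rate x i = 1/(2 h i) one may charge every position, except the first one when
    its denominator is even. *)
Let weight d k s : R := (\prod_(k + ~~ odd (cden s) <= i < k + d) (1 - x i)) * cyl_len R s.

Let weight_ge0 d k s : valid s -> 0 <= weight d k s.
Proof.
move=> vs; rewrite mulr_ge0 //; last exact/ltW/cyl_len_gt0.
by have /andP[] := prod_1B_le (k + ~~ odd (cden s)) (k + d) x01.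
Qed.

Let weight_step d k s n : valid s ->
  \sum_(1 <= a < n.+1 | small_digit k s a) weight d k.+1 (next_convergents s a) <=
  weight d.+1 k s.
Proof.
move=> vs; have [_ _ det] := vs.
pose P j : R := \prod_(j <= i < k + d.+1) (1 - x i).
have P0 j : 0 <= P j by have /andP[] := prod_1B_le j (k + d.+1) x01.
have Pstep j : (j < k + d.+1)%N -> P j = (1 - x j) * P j.+1.
  by move=> jk; rewrite /P big_ltn.
have PS j : P j <= P j.+1.
  have [jk|kj] := ltnP j (k + d.+1); last by rewrite /P !big_geq // ltnW.
  by rewrite Pstep // ler_piMl //; have /andP[? ?] := x01 j; lra.
have len0 a : (1 <= a)%N -> 0 <= cyl_len R (next_convergents s a).
  by move=> a0; apply/ltW/cyl_len_gt0; exact: valid_next.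
have weightE a : weight d k.+1 (next_convergents s a) =
    P (k.+1 + ~~ odd (a * cden s + pden s))%N * cyl_len R (next_convergents s a).
  by rewrite /weight /P (addSnnS k d).
rewrite (eq_bigr _ (fun a _ => weightE a)) /weight -/(P _).
have [oq|eq_] := boolP (odd (cden s)).
- rewrite addn0 (eq_bigl (fun a => (a < h k)%N)); last by move=> a; rewrite /small_digit oq.
  apply: (@le_trans _ _ (P k.+2 * ((1 - (h k)%:R^-1) * cyl_len R s))).
    apply: (le_trans _ (ler_wpM2l (P0 k.+2) (sum_cyl_len_lt R n (h_gt0 k) vs))).
    rewrite mulr_sumr [leLHS]big_nat_cond [leRHS]big_nat_cond.
    apply: ler_sum => a /andP[/andP[a0 _] _]; apply: ler_wpM2r; first exact: len0.
    by case: (odd _); rewrite /= ?addn0 ?addn1.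
  rewrite mulrA ler_wpM2r //; first exact/ltW/cyl_len_gt0.
  have -> : (h k)%:R^-1 = 2 * x k by rewrite /x invfM mulrA divff // mul1r.
  have [xk0 xk1] := andP (x01 k); have [xk0' xk1'] := andP (x01 k.+1).
  (* The next denominator may be even, so this step must pay for two positions. *)
  have le_x : x k.+1 <= x k.
    by rewrite /x lef_pV2 ?posrE ?mulr_gt0 ?ltr0n ?h_gt0 // ler_pM2l // ler_nat h_nondecr.
  rewrite (@Pstep k); last by lia.
  have [d0|d1] := posnP d.
    by rewrite /P d0 !big_geq; [lra | lia..].
  rewrite (@Pstep k.+1); last by lia.
  rewrite mulrA mulrC ler_wpM2r //; nra.
- have oq' : odd (pden s).
    move: det eq_; case=> /(congr1 odd); rewrite oddD !oddM;
    by case: (odd (cden s)); case: (odd (pden s)); rewrite ?andbF.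
  rewrite addn1 (eq_bigr (fun a => P k.+1 * cyl_len R (next_convergents s a))); last first.
    by move=> a _; rewrite oddD oddM (negbTE eq_) oq' andbF addn0.
  by rewrite -mulr_sumr ler_wpM2l // sum_cyl_len_le.
Qed.

Hypothesis h_div : forall B : R, exists n, B <= \sum_(0 <= i < n) (h i)%:R^-1.

Let small_tree k s := \bigcap_d @tree R small_digit xpredT d k s.

Let small_tree_negligible k s : valid s -> mu.-negligible (small_tree k s).
Proof.
move=> vs; have mt d := @measurable_tree R small_digit xpredT d k s vs.
have mS : measurable (small_tree k s) by exact: bigcapT_measurable.
apply/negligibleP => //; apply/eqP; rewrite eq_le measure_ge0 andbT.
apply/lee_addgt0Pr => e e0; rewrite add0e.
set j := (k + ~~ odd (cden s))%N.
have [n hn] := h_div (2 * (cyl_len R s / e) + \sum_(0 <= i < j) (h i)%:R^-1).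
have len := cyl_len_gt0 R vs.
have sum_ge : cyl_len R s / e <= \sum_(j <= i < k + (n + j)) x i.
  have hi i : 0 <= (h i)%:R^-1 :> R by rewrite invr_ge0.
  have : \sum_(0 <= i < n) (h i)%:R^-1 <= \sum_(0 <= i < k + (n + j)) (h i)%:R^-1 :> R.
    rewrite [leRHS](@big_cat_nat _ _ _ n) //=; last by lia.
    by rewrite lerDl sumr_ge0 // => i _; exact: hi.
  rewrite [X in _ <= X -> _](@big_cat_nat _ _ _ j) //=; last by rewrite /j; lia.
  have -> : \sum_(j <= i < k + (n + j)) x i = 2^-1 * \sum_(j <= i < k + (n + j)) (h i)%:R^-1.
    by rewrite mulr_sumr; apply: eq_bigr => i _; rewrite /x invfM.
  by move=> hn'; have := le_trans hn hn'; lra.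
apply: (@le_trans _ _ (weight (n + j) k s)%:E).
  apply: (@le_trans _ _ (mu (tree small_digit xpredT (n + j) k s))).
    apply: le_measure; rewrite ?inE; [exact: mS | exact: mt |].
    by move=> t; apply.
  apply: (tree_measure weight_ge0 _ weight_step) => // k' s' vs' _.
  by rewrite /weight big_geq ?mul1r //; lia.
rewrite lee_fin /weight -/j; have /andP[_ Ple] := prod_1B_le j (k + (n + j)) x01.
apply: le_trans (ler_wpM2r (ltW len) Ple) _.
have S0 : 0 < 1 + \sum_(j <= i < k + (n + j)) x i.
  by rewrite ltr_wpDr // sumr_ge0 // => i _; have /andP[] := x01 i.
rewrite mulrC ler_pdivrMr // -ler_pdivrMl // mulrC; lra.
Qed.

(** The exceptional numbers avoid large digits at all positions from some
    position on, hence lie in one of countably many negligible sets, indexed by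
    the word of their first digits. *)
Lemma frequent_large_digits :
  {ae mu, forall theta, irrational theta -> 0 < theta < 1 -> forall K, exists k,
    let s := expansion theta k unit_interval in
    [/\ (K <= k)%N, odd (cden s) & (h k <= digit theta s)%N]}.
Proof.
pose word w := foldl next_convergents unit_interval w.
pose N (n : nat) := if unpickle n is Some w then
  (if `[< valid (word w) >] then small_tree (size w) (word w) else set0) else set0.
have neg : mu.-negligible (\bigcup_n N n).
  apply: negligible_bigcup => n; rewrite /N; case: unpickle => [w|]; last exact: negligible_set0.
  case: asboolP => [vw|_]; last exact: negligible_set0.
  exact: small_tree_negligible.
apply: negligibleS neg => theta /= /not_implyP[irr] /not_implyP[t01] /existsNP[K HK].
have cs := cylinder_unit_interval t01.
have [vK cK] := expansion_valid K irr valid_unit_interval cs.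
pose w := [seq digit theta (expansion theta i unit_interval) | i <- iota 0 K].
have ew : expansion theta K unit_interval = word w by rewrite expansion_foldl.
exists (pickle w) => //; rewrite /N pickleK -ew asboolT //.
have -> : size w = K by rewrite size_map size_iota.
move=> d _; apply: expansion_in_tree => // i _; apply/implyP => oi; rewrite ltnNge; apply/negP => hi.
apply: HK; exists (K + i)%N => /=.
have -> : expansion theta (K + i) unit_interval = expansion theta i (expansion theta K unit_interval).
  by rewrite /expansion addnC iterD.
by split=> //; rewrite leq_addr.
Qed.

End FrequentLargeDigits.

(** * Comparison of integrals with sums over a grid *)

Section IntegralTest.
Variable R : realType.
Implicit Types (u : R -> R) (c C t : R) (k n : nat).
Local Notation mu := (@lebesgue_measure R).

Section Grid.
Variables (C c : R) (u : R -> R).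
Hypothesis c0 : 0 < c.
Hypothesis u0 : {in `[C, +oo[, forall x, 0 <= u x}.
Hypothesis u_ni : {in `[C, +oo[ &, {homo u : x y /~ x <= y}}.

Let A k : set R := `[C + k%:R * c, C + k.+1%:R * c[%classic.

Let grid_in k : C + k%:R * c \in `[C, +oo[.
Proof. by rewrite in_itv /= andbT lerDl mulr_ge0 // ltW. Qed.

Let A_in k t : A k t -> t \in `[C, +oo[.
Proof.
rewrite /A /= !in_itv /= andbT => /andP[h _]; apply: le_trans h.
by have := grid_in k; rewrite in_itv /= andbT.
Qed.

Let measurable_A k : measurable (A k).
Proof. by rewrite /A. Qed.

Let bigcup_A : \bigcup_k A k = `[C, +oo[%classic.
Proof.
apply/seteqP; split=> [t [k _] /A_in //|t /=]; rewrite in_itv /= andbT => Ct.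
have t0 : 0 <= (t - C) / c by rewrite divr_ge0 ?subr_ge0 // ltW.
exists (Num.truncn ((t - C) / c)) => //.
have /andP[] := truncn_itv t0; rewrite ler_pdivlMr // ltr_pdivrMr // => h1 h2.
by rewrite /A /= in_itv /=; apply/andP; split; lra.
Qed.

Let trivIset_A : trivIset setT A.
Proof.
apply/trivIsetP => i j _ _; wlog ij : i j / (i < j)%N.
  move=> H ne; have [ij|ji|e] := ltngtP i j; [exact: H| |by rewrite e eqxx in ne].
  by rewrite setIC; apply: H => //; rewrite eq_sym.
move=> _; apply/seteqP; split=> // t []; rewrite /A /= !in_itv /= => /andP[_ h1] /andP[h2 _].
have : i.+1%:R * c <= j%:R * c by rewrite ler_wpM2r ?ler_nat // ltW.
lra.
Qed.

Let measurable_u : measurable_fun `[C, +oo[%classic (EFin \o u).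
Proof.
apply/measurable_EFinP.
apply: (@eq_measurable_fun _ _ _ _ _ (fun x => u (Num.max C x))).
  move=> x; rewrite inE /= in_itv /= andbT => Cx.
  by congr u; rewrite (max_idPr Cx).
apply: nonincreasing_measurable => // x y xy.
apply: u_ni; [by rewrite in_itv /= andbT le_max lexx.. |].
by rewrite ge_max !le_max lexx xy orbT.
Qed.

Let integral_A : (\int[mu]_(s in `[C, +oo[) (u s)%:E =
  \sum_(0 <= k <oo) \int[mu]_(s in A k) (u s)%:E)%E.
Proof.
by rewrite -bigcup_A ge0_integral_bigcup // ?bigcup_A.
Qed.

Let measure_A k : mu (A k) = c%:E.
Proof.
rewrite /A lebesgue_measure_itv /= lte_fin -natr1 mulrDl mul1r ltrD2l ltrDl c0 -EFinB.
by congr EFin; ring.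
Qed.

Let measurable_uA k : measurable_fun (A k) (EFin \o u).
Proof.
apply: measurable_funS measurable_u => //; by move=> x /A_in.
Qed.

Let integral_A_le k : (\int[mu]_(s in A k) (u s)%:E <= (u (C + k%:R * c) * c)%:E)%E.
Proof.
apply: (@le_trans _ _ (\int[mu]_(s in A k) (cst (u (C + k%:R * c))%:E s))%E).
  apply: ge0_le_integral => //.
  - exact: measurable_A.
  - by move=> x /A_in /u0; rewrite -lee_fin.
  - exact: measurable_uA.
  - move=> x Ax; rewrite lee_fin /=; apply: u_ni; [exact: A_in Ax | exact: grid_in | ].
    by move: Ax; rewrite /A /= in_itv /= => /andP[].
by rewrite integral_cst; [rewrite [X in (_ * X)%E](measure_A k) EFinM | exact: measurable_A].
Qed.

Let integral_A_ge k : ((u (C + k.+1%:R * c) * c)%:E <= \int[mu]_(s in A k) (u s)%:E)%E.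
Proof.
apply: (@le_trans _ _ (\int[mu]_(s in A k) (cst (u (C + k.+1%:R * c))%:E s))%E).
  by rewrite integral_cst; [rewrite [X in (_ * X)%E](measure_A k) EFinM | exact: measurable_A].
apply: ge0_le_integral => //.
- exact: measurable_A.
- by move=> x _; rewrite lee_fin u0.
- exact: measurable_uA.
- move=> x Ax; rewrite lee_fin /=; apply: u_ni; [exact: grid_in | exact: A_in Ax| ].
  by move: Ax; rewrite /A /= in_itv /= => /andP[_ /ltW].
Qed.

Lemma integral_lty_grid_sum :
  (\int[mu]_(s in `[C, +oo[) (u s)%:E < +oo)%E ->
  exists B, forall n, \sum_(0 <= k < n) u (C + k.+1%:R * c) <= B.
Proof.
rewrite integral_A => fin_int.
exists (fine (\sum_(0 <= k <oo) \int[mu]_(s in A k) (u s)%:E)%E / c) => n.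
have ge0 k : (0 <= \int[mu]_(s in A k) (u s)%:E)%E.
  by apply: integral_ge0 => x /A_in /u0 ux; rewrite lee_fin.
rewrite ler_pdivlMr // mulr_suml -lee_fin fineK; last first.
  by rewrite ge0_fin_numE // nneseries_ge0.
rewrite -sumEFin; apply: le_trans (nneseries_lim_ge n _); last by move=> k _ _.
by apply: lee_sum => k _; exact: integral_A_ge.
Qed.

Lemma integral_pinfty_grid_sum :
  (\int[mu]_(s in `[C, +oo[) (u s)%:E = +oo)%E ->
  forall B, exists n, B <= \sum_(0 <= k < n) u (C + k%:R * c).
Proof.
rewrite integral_A => inf_int B; apply: contrapT => /forallNP H.
suff : (\sum_(0 <= k <oo) \int[mu]_(s in A k) (u s)%:E <= (B * c)%:E)%E by rewrite inf_int.
apply: lime_le.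
  apply: is_cvg_nneseries => k _ _.
  by apply: integral_ge0 => x /A_in /u0 ux; rewrite lee_fin.
apply: nearW => n; apply: (@le_trans _ _ (\sum_(0 <= k < n) (u (C + k%:R * c) * c)%:E)%E).
  by apply: lee_sum => k _; exact: integral_A_le.
rewrite sumEFin lee_fin -mulr_suml ler_pM2r //.
by have /negP := H n; rewrite -ltNge => /ltW.
Qed.

End Grid.

Section Primitive.
Variables (C : R) (f : R -> R).
Hypothesis f_cont : {within `[C, +oo[, continuous f}.
Hypothesis f_pos : {in `[C, +oo[, forall x, 0 < f x}.
Hypothesis f_nd : {in `[C, +oo[ &, {homo f : x y / x <= y}}.

Let F t := \int[mu]_(s in `[C, t]) f s.

Let f_int s t : C <= s -> mu.-integrable `[s, t]%classic (EFin \o f).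
Proof.
move=> Cs; apply: continuous_compact_integrable; first exact: segment_compact.
apply: continuous_subspaceW f_cont => x /=; rewrite !in_itv /= andbT => /andP[sx _].
exact: le_trans sx.
Qed.

Lemma primitive_incr s t : C <= s -> s <= t -> F s + (t - s) * f s <= F t.
Proof.
move=> Cs st; rewrite -lerBrDl /F.
rewrite (Rintegral_itvB (f_int t (lexx C))) ?bnd_simp //.
have sub : (`]s, t]%classic : set R) `<=` `[s, t]%classic.
  by move=> x /=; rewrite !in_itv /= => /andP[/ltW -> ->].
apply: (@le_trans _ _ (\int[mu]_(x in `]s, t]) (cst (f s) x))).
  have mst : mu `]s, t]%classic = (t - s)%:E.
    rewrite lebesgue_measure_itv /= lte_fin; have [s_t|t_s|->] := ltgtP s t.
    - by rewrite EFinB.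
    - by move: st; rewrite leNgt t_s.
    - by rewrite subrr.
  by rewrite Rintegral_cst // [X in fine X]mst /= mulrC.
have int_cst : mu.-integrable `[s, t]%classic (EFin \o cst (f s)).
  apply: continuous_compact_integrable; first exact: segment_compact.
  by apply: continuous_subspaceT => x; exact: cvg_cst.
apply: le_Rintegral => //.
- by apply: integrableS int_cst.
- by apply: integrableS (f_int t Cs).
- move=> x; rewrite /= in_itv /= => /andP[sx xt].
  by apply: f_nd; rewrite ?in_itv /= ?andbT ?(ltW sx) // (le_trans Cs) // ltW.
Qed.

Let F_ge0 t : 0 <= F t.
Proof.
apply: Rintegral_ge0 => x /=; rewrite in_itv /= => /andP[Cx _].
by apply/ltW/f_pos; rewrite in_itv /= Cx.
Qed.

(** Lower Riemann sums of a nondecreasing function, on the grid of the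
    multiples of c. *)
Lemma primitive_ge_sum c i n : 0 < c -> C <= i%:R * c -> (i <= n)%N ->
  c * \sum_(i <= k < n) f (k%:R * c) <= F (n%:R * c).
Proof.
move=> c0 Ci; elim: n => [|n IH].
  by rewrite leqn0 => /eqP ->; rewrite big_geq // mulr0 F_ge0.
rewrite leq_eqVlt => /orP[/eqP <-|].
  by rewrite big_geq // mulr0 F_ge0.
rewrite ltnS => i_n; rewrite big_nat_recr //= mulrDr.
have Cn : C <= n%:R * c by apply: le_trans Ci _; rewrite ler_pM2r // ler_nat.
have nn : n%:R * c <= n.+1%:R * c by rewrite ler_pM2r // ler_nat.
apply: le_trans (primitive_incr Cn nn).
have -> : n.+1%:R * c - n%:R * c = c by rewrite -natr1; ring.
by rewrite lerD2r; exact: IH.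
Qed.

End Primitive.
End IntegralTest.

(** * Numbers with good rational approximations *)

Section KhinchinConvergence.
Variable R : realType.
Implicit Types (theta : R) (j n p q : nat).
Local Notation mu := (@lebesgue_measure R).

Lemma measure_bigsetU_le (I : Type) (r : seq I) (F : I -> set R) :
  (forall i, measurable (F i)) ->
  (mu (\big[setU/set0]_(i <- r) F i) <= \sum_(i <- r) mu (F i))%E.
Proof.
move=> mF; elim: r => [|i r IH]; first by rewrite !big_nil measure0.
have mr : measurable (\big[setU/set0]_(j <- r) F j) by exact: bigsetU_measurable.
rewrite !big_cons; apply: (@le_trans _ _ (mu (F i) + mu (\big[setU/set0]_(j <- r) F j))%E).
  exact: (measureU2 mu (mF i) mr).
exact: leeD.
Qed.

Let window j q p : set R :=
  `](p%:R - (2 ^+ j)^-1) / q%:R, (p%:R + (2 ^+ j)^-1) / q%:R[%classic.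

Let window_measure j q p : (0 < q)%N -> mu (window j q p) = (2 / (2 ^+ j * q%:R))%:E.
Proof.
move=> q0; have q0r : 0 < q%:R :> R by rewrite ltr0n.
have x0 : 0 < (2 ^+ j)^-1 :> R by rewrite invr_gt0 exprn_gt0.
rewrite /window lebesgue_measure_itv /= lte_fin.
rewrite ltr_pM2r ?invr_gt0 // ifT; last by lra.
by rewrite -EFinB invfM; congr EFin; ring.
Qed.

Let windows N j : set R :=
  \big[setU/set0]_(1 <= q < N.+1) \big[setU/set0]_(0 <= p < q.+1) window j q p.

Let measurable_windows N j : measurable (windows N j).
Proof.
by apply: bigsetU_measurable => q _; apply: bigsetU_measurable => p _; rewrite /window.
Qed.

Let windows_measure N j : (mu (windows N j) <= (4 * N%:R / 2 ^+ j)%:E)%E.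
Proof.
have mw q p : measurable (window j q p) by rewrite /window.
apply: le_trans (measure_bigsetU_le _ _) _.
  by move=> q; apply: bigsetU_measurable => p _.
apply: (@le_trans _ _ (\sum_(1 <= q < N.+1) (4 / 2 ^+ j)%:E)%E).
  rewrite big_nat [leRHS]big_nat; apply: lee_sum => q /andP[q0 _].
  apply: le_trans (measure_bigsetU_le _ _) _; first by [].
  under eq_bigr do rewrite window_measure //.
  rewrite sumEFin lee_fin big_const_nat iter_addr_0.
  have q0r : 1 <= q%:R :> R by rewrite ler1n.
  have x0 : 0 < 2 ^+ j :> R by rewrite exprn_gt0.
  have -> : 2 / (2 ^+ j * q%:R) *+ (q.+1 - 0) = 2 / 2 ^+ j * (1 + q%:R^-1) :> R.
    by rewrite subn0 -mulr_natr -natr1; field; rewrite !gt_eqF //; lra.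
  have y0 : 0 < (2 ^+ j)^-1 :> R by rewrite invr_gt0.
  have : q%:R^-1 <= 1 :> R by rewrite invf_le1 //; lra.
  by move: (q%:R^-1) => y y1; nra.
rewrite sumEFin lee_fin big_const_nat subn1 /= iter_addr_0 -mulr_natr.
by rewrite le_eqVlt; apply/orP; left; apply/eqP; ring.
Qed.

(** For the level j, the windows around the fractions in [0, 1] with denominator
    q <= 2^j / b j have total measure at most 4 / b j: for each q there are q + 1
    windows of length 2 / (2^j q).  The conclusion is the Borel-Cantelli lemma. *)
Lemma eventually_badly_approximable (b : nat -> R) (B : R) :
  (forall j, 0 < b j) -> (forall n, \sum_(0 <= j < n) (b j)^-1 <= B) ->
  {ae mu, forall theta, 0 < theta < 1 -> exists J, forall j p q, (J <= j)%N -> (0 < q)%N ->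
    `|q%:R * theta - p%:R| * 2 ^+ j < 1 -> 2 ^+ j / q%:R < b j}.
Proof.
move=> b0 bB.
pose N j := Num.truncn (2 ^+ j / b j).
pose E j := windows (N j) j.
have neg : mu.-negligible (lim_sup_set E).
  apply: (@borel_cantelli_bounded R E (fun j => 4 * (b j)^-1) (4 * B)) => [j|j|n].
  - exact: measurable_windows.
  - apply: le_trans (windows_measure _ _) _; rewrite lee_fin.
    have x0 : 0 < 2 ^+ j :> R by rewrite exprn_gt0.
    rewrite -mulrA ler_pM2l // ler_pdivrMr // mulrC truncn_le.
    by rewrite divr_ge0 ?ltW.
  - by rewrite -mulr_sumr ler_pM2l.
apply: negligibleS neg => theta /= /not_implyP[/andP[t0 t1]] /forallNP H n _.
have := H n => /existsNP[j] /existsNP[p] /existsNP[q] /not_implyP[nj] /not_implyP[q0].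
move=> /not_implyP[hd] /negP; rewrite -leNgt => hb.
exists j => //.
have x0 : 0 < 2 ^+ j :> R by rewrite exprn_gt0.
have x1 : 1 <= 2 ^+ j :> R by rewrite exprn_ege1 // ler1n.
have q0r : 0 < q%:R :> R by rewrite ltr0n.
have qN : (q <= N j)%N.
  rewrite /N truncn_ge_nat; last by rewrite divr_ge0 ?ltW.
  by move: hb; rewrite !ler_pdivlMr // mulrC.
move: hd; rewrite -ltr_pdivlMr // div1r ltr_norml => /andP[d1 d2].
have x2 : (2 ^+ j)^-1 <= 1 :> R by rewrite invf_le1.
have pq : (p <= q)%N.
  have : p%:R < q.+1%:R :> R.
    have : q%:R * theta < q%:R by rewrite gtr_pMr.
    by rewrite -natr1; lra.
  by rewrite ltr_nat ltnS.
rewrite /E /windows (big_cat_nat _ (n := q)) //=; last by lia.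
right; rewrite big_ltn ?ltnS //; left.
rewrite (big_cat_nat _ (n := p)) //=; last by lia.
right; rewrite big_ltn ?ltnS //; left.
rewrite /window /= in_itv /= ltr_pdivrMr // ltr_pdivlMr //.
by apply/andP; split; lra.
Qed.

End KhinchinConvergence.

(** * Growth of the discrepancy *)

Section Main.
Variables (R : realType) (C : R) (f : R -> R).
Hypothesis C_gt0 : 0 < C.
Hypothesis f_cont : {within `[C, +oo[, continuous f}.
Hypothesis f_pos : {in `[C, +oo[, forall x, 0 < f x}.
Hypothesis f_nondecr : {in `[C, +oo[ &, {homo f : x y / x <= y}}.
Local Notation mu := (@lebesgue_measure R).
Local Notation F := (fun t : R => \int[mu]_(s in `[C, t]) f s).

Let in_dom x : C <= x -> x \in `[C, +oo[.
Proof. by rewrite in_itv /= andbT. Qed.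

Let grid_dom (c : R) k : 0 < c -> C <= C + k%:R * c.
Proof. by move=> c0; rewrite lerDl mulr_ge0 // ltW. Qed.

Let f_le x y : C <= x -> x <= y -> f x <= f y.
Proof. by move=> Cx xy; apply: f_nondecr => //; apply: in_dom => //; exact: le_trans xy. Qed.

Let finv_ge0 : {in `[C, +oo[, forall x, 0 <= (f x)^-1}.
Proof. by move=> x /f_pos fx; rewrite invr_ge0 ltW. Qed.

Let finv_nonincr : {in `[C, +oo[ &, {homo (fun x => (f x)^-1) : x y /~ x <= y}}.
Proof.
by move=> x y xC yC xy; rewrite lef_pV2 ?posrE ?f_pos //; exact: f_nondecr.
Qed.

Lemma regularly_varying_doubling : regularly_varying f ->
  exists B x0 : R, [/\ 0 < B, C <= x0 & forall x, x0 <= x -> f (2 * x) <= B * f x].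
Proof.
move=> /(_ 2 (ltr0n R 2)) [a [B [_ B0 ab]]].
have [x0 Cx0 h] : exists2 x0, C <= x0 & forall x, x0 <= x -> a <= f (2 * x) / f x <= B.
  have [M [_ hM]] := ab; exists (Num.max C (M + 1)); first by rewrite le_max lexx.
  by move=> x; rewrite ge_max => /andP[_ Mx]; apply: hM; lra.
exists B, x0; split=> // x x0x; have /andP[_] := h x x0x.
by rewrite ler_pdivrMr // f_pos // in_dom // (le_trans Cx0).
Qed.

Let L : R := ln 2.

Let L_gt0 : 0 < L.
Proof. by rewrite ln_gt0 // ltr1n. Qed.

Let ln_pow2 (t : nat) : ln (2 ^+ t) = t%:R * L.
Proof. by rewrite lnXn // mulr_natl. Qed.

(** With b j of the form f (C + (j+1) ln 2) / (m+1), doubling the argument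
    shows that b j is at most a constant over m + 1 times f ((j-1) ln 2), and
    these values form a lower Riemann sum of F (ln n).  The integer m is then
    chosen according to eps, and the part of the sum due to the small levels
    is absorbed because F tends to infinity. *)
Lemma rho_littleo theta x : regularly_varying f -> irrational theta -> 0 < theta < 1 ->
  (forall m : nat, exists J, forall j p q : nat, (J <= j)%N -> (0 < q)%N ->
    `|q%:R * theta - p%:R| * 2 ^+ j < 1 ->
    2 ^+ j / q%:R < m.+1%:R^-1 * f (C + j.+1%:R * L)) ->
  rho theta x =o_\oo (fun n : nat => F (ln n%:R)).
Proof.
move=> rv irr t01 bad.
have [B [x0 [B0 Cx0 dbl]]] := regularly_varying_doubling rv.
apply/eqoP => eps_; move: (eps_ : R) => {eps_} eps eps0.
(* 80 = 2 * 20 * 2: rho is twice the bound of the sums, each level costs 20 b j,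
   and only half of eps is available. *)
pose m := Num.truncn (80 * B / (eps * L)).
have hm : 80 * B / (eps * L) < m.+1%:R by exact: truncnS_gt.
have [J hJ] := bad m.
(* From the index i0 on, C + (j+1) L <= 2 (j-1) L, and doubling is available. *)
pose i0 := Num.truncn (Num.max x0 (C + 3 * L) / L).
have hi0 : Num.max x0 (C + 3 * L) <= i0.+1%:R * L.
  by rewrite -ler_pdivrMr // ltW // truncnS_gt.
move: hi0; rewrite ge_max => /andP[hi1 hi2].
have [j0 Jj0 ij0] : exists2 j0, (J <= j0)%N & (i0.+1 < j0)%N.
  by exists (maxn J i0.+2); [exact: leq_maxl | exact: leq_maxr].
have pred_j0 j : (j0 <= j)%N -> (j0.-1 <= j.-1)%N by clear; lia.
have j0i : i0.+1%:R <= j0.-1%:R :> R by rewrite ler_nat; clear -ij0; lia.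
have j0L : i0.+1%:R * L <= j0.-1%:R * L by rewrite ler_pM2r.
have j0S : (0 < j0)%N by exact: leq_trans ij0.
have Cj0 : C <= j0.-1%:R * L by lra.
pose b j := m.+1%:R^-1 * f (C + j.+1%:R * L).
have b_le j : (j0 <= j)%N -> b j <= m.+1%:R^-1 * B * f (j.-1%:R * L).
  move=> jj; rewrite /b -mulrA ler_wpM2l ?invr_ge0 //.
  have jL : j0.-1%:R * L <= j.-1%:R * L by rewrite ler_pM2r // ler_nat pred_j0.
  apply: le_trans (_ : f (2 * (j.-1%:R * L)) <= _); last by apply: dbl; lra.
  apply: f_le; first by apply: grid_dom.
  have -> : j.+1%:R = j.-1%:R + 2 :> R by rewrite -natrD; congr _%:R; clear -jj j0S; lia.
  by lra.
have S_le j y N : (j0 <= j)%N -> (N < 2 ^ j)%N ->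
    `|discr_sum theta y N| <= (2 ^ j0)%:R + 20 * \sum_(j0 <= i < j) b i.
  apply: discr_sum_dyadic => {}j jj.
  have [p [q [/andP[q0 qj] cpq hd]]] := @dirichlet R theta (2 ^ j) irr t01 (expn_gt0 2 j).
  exists p, q; split=> //; first by rewrite q0.
    exact: ltW.
  by rewrite natrX; apply/ltW/(hJ j p q) => //; [exact: leq_trans jj | rewrite -natrX].
pose K : R := 1 + 2 * (2 ^ j0)%:R.
have main t N : (j0 <= t)%N -> (2 ^ t <= N < 2 ^ t.+1)%N ->
   `|rho theta x N| <= K + eps / 2 * F (ln N%:R) /\
   L * ((t - j0.-1)%:R * f C) <= F (ln N%:R).
  move=> tj /andP[tN Nt].
  have N0 : (0 < N)%N by apply: leq_trans tN; rewrite expn_gt0.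
  have tL : t%:R * L <= ln N%:R.
    by rewrite -ln_pow2 ler_ln ?posrE ?exprn_gt0 ?ltr0n // -natrX ler_nat.
  have jt : (j0.-1 <= t)%N by exact: leq_trans (leq_pred _) tj.
  have C_tL : C <= t%:R * L.
    by apply: le_trans Cj0 _; rewrite ler_pM2r // ler_nat.
  have F_ge : L * \sum_(j0.-1 <= k < t) f (k%:R * L) <= F (ln N%:R).
    apply: le_trans (primitive_ge_sum f_cont f_pos f_nondecr L_gt0 Cj0 jt) _.
    apply: le_trans (primitive_incr f_cont f_nondecr C_tL tL).
    by rewrite lerDl mulr_ge0 ?subr_ge0 // ltW // f_pos // in_dom.
  split; last first.
    apply: le_trans F_ge; rewrite ler_pM2l //.
    have -> : (t - j0.-1)%:R * f C = \sum_(j0.-1 <= k < t) f C.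
      by rewrite big_const_nat iter_addr_0 mulr_natl.
    rewrite big_nat [leRHS]big_nat; apply: ler_sum => k /andP[jk _].
    apply: f_le => //; apply: le_trans Cj0 _; rewrite ler_pM2r // ler_nat //.
  rewrite ger0_norm; last by apply: le_trans (rho_ge1 _ _ _).
  have b_sum : \sum_(j0 <= i < t.+1) b i <=
      m.+1%:R^-1 * B * \sum_(j0.-1 <= k < t) f (k%:R * L).
    rewrite -[in leLHS](prednK j0S) big_add1 /= mulr_sumr.
    rewrite big_nat [leRHS]big_nat; apply: ler_sum => i /andP[ji _].
    by apply: (b_le i.+1); clear -ji; lia.
  apply: le_trans (@rho_le _ theta x N
    ((2 ^ j0)%:R + 20 * \sum_(j0 <= i < t.+1) b i) N0 _) _.
    by move=> i iN; apply: S_le; [exact: leqW | exact: leq_ltn_trans Nt].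
  rewrite /K mulrDr addrA lerD2l.
  set S := \sum_(j0.-1 <= k < t) _ in b_sum F_ge.
  have S0 : 0 <= S.
    rewrite /S big_nat sumr_ge0 // => k /andP[jk _]; apply/ltW/f_pos/in_dom.
    by apply: le_trans Cj0 _; rewrite ler_pM2r // ler_nat.
  apply: (@le_trans _ _ (eps / 2 * (L * S))); last by rewrite ler_pM2l // divr_gt0.
  have mB : 80 * (m.+1%:R^-1 * B) <= eps * L.
    have -> : 80 * (m.+1%:R^-1 * B) = 80 * B / m.+1%:R by rewrite mulrCA mulrC.
    rewrite ler_pdivrMr // [leRHS]mulrC.
    by rewrite -ler_pdivrMr ?mulr_gt0 // ltW.
  have := ler_wpM2r S0 mB; move: b_sum; move: L (S) (m.+1%:R^-1) (\sum_(_ <= i < _) b i).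
  by move=> l S1 r s; lra.
(* After T more doublings, F (ln n) exceeds the fixed part K of the bound. *)
pose T := Num.truncn (2 * K / (eps * (L * f C))).
exists (2 ^ (j0 + T.+1))%N => // N /= TN.
have N0 : (0 < N)%N by apply: leq_trans TN; rewrite expn_gt0.
pose t := trunc_log 2 N.
have tN : (2 ^ t <= N < 2 ^ t.+1)%N by rewrite trunc_logP //= trunc_log_ltn.
have tT : (j0 + T.+1 <= t)%N by exact: trunc_log_max.
have jt : (j0 <= t)%N by apply: leq_trans tT; exact: leq_addr.
have [h1 h2] := main t N jt tN.
have fC : 0 < f C by apply/f_pos/in_dom.
have KT : 2 * K < T.+1%:R * (eps * (L * f C)).
  by rewrite -ltr_pdivrMr ?truncnS_gt // !mulr_gt0.
have TS : T.+1%:R <= (t - j0.-1)%:R :> R by rewrite ler_nat; clear -tT; lia.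
have := ler_wpM2r (ltW (mulr_gt0 eps0 (mulr_gt0 L_gt0 fC))) TS => h3.
have h4 := ler_wpM2l (ltW eps0) h2.
have h5 : 2 * K <= eps * F (ln N%:R) by lra.
apply: le_trans h1 _.
have : F (ln N%:R) <= `|F (ln N%:R)| by exact: ler_norm.
move=> /(ler_wpM2l (ltW eps0)); lra.
Qed.

Let c : R := ln 16.

Let c_gt0 : 0 < c.
Proof. by rewrite ln_gt0 // ltr1n. Qed.

(** As 16^(k+1) bounds the denominator q_(k+1), it is the time at which the effect
    of the digit a_(k+1) is complete; (k+1) c is its logarithm.  The shift by C
    keeps the argument of f in its domain. *)
Let ht k : nat := (Num.truncn (f (C + k.+1%:R * c))).+1.

(** A digit at least 4 * ht k after an odd denominator makes rho at least
    ht k at the time 16^(k+1), while f (ln n) < ht k at this time. *)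
Lemma rho_not_littleo theta x : irrational theta -> 0 < theta < 1 ->
  (exists K, forall k, (K <= k)%N -> (cden (expansion theta k unit_interval) <= 16 ^ k)%N) ->
  (forall K, exists k, let s := expansion theta k unit_interval in
    [/\ (K <= k)%N, odd (cden s) & (4 * ht k <= digit theta s)%N]) ->
  ~ (rho theta x =o_\oo (fun n : nat => f (ln n%:R))).
Proof.
move=> irr t01 [K0 growth] large /eqoP /(_ 2^-1) [|N0 _ small]; first by rewrite invr_gt0.
pose K := maxn K0 (maxn N0 (Num.truncn (C / c))).
have [k [Kk oq hd]] := large K; set s := expansion theta k unit_interval in oq hd.
have cs := cylinder_unit_interval t01.
have [vs cys] := expansion_valid k irr (valid_unit_interval) cs; rewrite -/s in vs cys.
have [q0 _ _] := vs.
have err := cerr_lt irr vs cys.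
have cden_descend : (4 * ht k * cden s <= cden (descend theta s))%N.
  rewrite /descend /=; apply: leq_trans (leq_addr _ _).
  by rewrite leq_mul2r hd orbT.
have le16 : (cden (descend theta s) <= 16 ^ k.+1)%N.
  by apply: growth; apply: leq_trans (leq_trans Kk (leqnSn k)); exact: leq_maxl.
have rho_big : (ht k)%:R <= rho theta x (16 ^ k.+1).
  apply: (@rho_ge _ theta x (cnum s) (cden s)) => //; last by nia.
  rewrite -/(cerr s theta) mulrC; apply: le_lt_trans err.
  by rewrite ler_wpM2l // -!natrM ler_nat.
have lnN : ln (16 ^ k.+1)%:R = k.+1%:R * c.
  by rewrite natrX lnXn // mulr_natl.
have Ckc : C <= k.+1%:R * c.
  rewrite -ler_pdivrMr // ltW //; apply: lt_le_trans (truncnS_gt _) _.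
  rewrite ler_nat ltnS; apply: leq_trans Kk.
  exact: leq_trans (leq_maxr _ _) (leq_maxr _ _).
have f_small : f (k.+1%:R * c) < (ht k)%:R.
  apply: le_lt_trans (truncnS_gt _); apply: f_le => //.
  by rewrite lerDr ltW.
have f0 : 0 < f (k.+1%:R * c) by apply/f_pos/in_dom.
have N0N : (N0 <= 16 ^ k.+1)%N.
  apply: leq_trans (ltnW (ltn_expl k.+1 (isT : 1 < 16)%N)).
  apply: leqW; apply: leq_trans Kk; exact: leq_trans (leq_maxl _ _) (leq_maxr _ _).
have := small _ N0N; rewrite /= lnN (gtr0_norm f0) => h.
have : rho theta x (16 ^ k.+1) <= `|rho theta x (16 ^ k.+1)| by exact: ler_norm.
lra.
Qed.

Lemma ae_rho_littleo : regularly_varying f ->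
  (\int[mu]_(s in `[C, +oo[) ((f s)^-1)%:E < +oo)%E ->
  {ae mu, forall theta, irrational theta -> 0 < theta < 1 ->
    forall x, rho theta x =o_\oo (fun n : nat => F (ln n%:R))}.
Proof.
move=> rv fin_int.
have [B sumB] := integral_lty_grid_sum L_gt0 finv_ge0 finv_nonincr fin_int.
have bad m : {ae mu, forall theta, 0 < theta < 1 ->
    exists J, forall j p q : nat, (J <= j)%N -> (0 < q)%N ->
    `|q%:R * theta - p%:R| * 2 ^+ j < 1 ->
    2 ^+ j / q%:R < m.+1%:R^-1 * f (C + j.+1%:R * L)}.
  apply: (@eventually_badly_approximable _ _ (m.+1%:R * B)) => [j|n].
    by rewrite mulr_gt0 ?invr_gt0 // f_pos // in_dom // grid_dom.
  rewrite (eq_bigr (fun j => m.+1%:R * (f (C + j.+1%:R * L))^-1)); last first.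
    by move=> j _; rewrite invfM invrK.
  by rewrite -mulr_sumr ler_pM2l.
move/ae_foralln: bad; apply: filterS => theta h irr t01 x.
by apply: rho_littleo => // m; exact: h.
Qed.

Lemma ae_rho_not_littleo :
  (\int[mu]_(s in `[C, +oo[) ((f s)^-1)%:E = +oo)%E ->
  {ae mu, forall theta, irrational theta -> 0 < theta < 1 ->
    forall x, ~ (rho theta x =o_\oo (fun n : nat => f (ln n%:R)))}.
Proof.
move=> inf_int.
have h_gt0 k : (0 < 4 * ht k)%N by rewrite muln_gt0.
have h_nd : {homo (fun k => 4 * ht k)%N : k n / (k <= n)%N}.
  move=> k n kn; rewrite leq_mul2l /= ltnS le_truncn // f_le ?grid_dom //.
  by rewrite lerD2l ler_pM2r // ler_nat.
have h_div (A : R) : exists n, A <= \sum_(0 <= i < n) (4 * ht i)%:R^-1.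
  have fC : 0 < f C by apply/f_pos/in_dom.
  (* Rounding up costs a bounded factor, as f is bounded below by f C > 0. *)
  pose D := 4 * (1 + (f C)^-1).
  have D0 : 0 < D by rewrite mulr_gt0 // addr_gt0 // invr_gt0.
  have [n hn] := integral_pinfty_grid_sum c_gt0 finv_ge0 finv_nonincr inf_int (D * A + (f C)^-1).
  exists n; rewrite -(ler_pM2l D0).
  have step i : (f (C + i.+1%:R * c))^-1 <= D * (4 * ht i)%:R^-1.
    have fi : f C <= f (C + i.+1%:R * c) by apply: f_le; rewrite ?grid_dom.
    have f0 : 0 < f (C + i.+1%:R * c) by exact: lt_le_trans fi.
    have h0 : 0 < (4 * ht i)%:R :> R by rewrite ltr0n.
    rewrite ler_pdivlMr // mulrC ler_pdivrMr // natrM /D -mulrA ler_pM2l //.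
    rewrite /ht -natr1 mulrDl mul1r; apply: lerD; first by rewrite truncn_le ltW.
    by rewrite mulrC ler_pdivlMr // mul1r.
  have fi0 i : 0 <= (f (C + i%:R * c))^-1 by rewrite finv_ge0 // in_dom // grid_dom.
  have : \sum_(0 <= i < n) (f (C + i%:R * c))^-1 <=
      (f C)^-1 + \sum_(0 <= i < n) (f (C + i.+1%:R * c))^-1.
    have -> : (f C)^-1 = (f (C + 0%:R * c))^-1 by rewrite mul0r addr0.
    apply: (@le_trans _ _ (\sum_(0 <= i < n.+1) (f (C + i%:R * c))^-1)).
      by rewrite [leRHS]big_nat_recr //= lerDl.
    by rewrite big_nat_recl.
  have : \sum_(0 <= i < n) (f (C + i.+1%:R * c))^-1 <=
      D * \sum_(0 <= i < n) (4 * ht i)%:R^-1.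
    by rewrite mulr_sumr; apply: ler_sum => i _; exact: step.
  lra.
apply: negligibleS (negligibleU (@cden_growth R) (frequent_large_digits h_gt0 h_nd h_div)).
move=> theta H; apply: contrapT => /not_orP[/contrapT g /contrapT l]; apply: H => irr t01 x.
by apply: rho_not_littleo => //; [exact: g | exact: l].
Qed.

End Main.

Theorem theorem2 (R : realType) (C : R) (f : R -> R)
    (C_gt0 : 0 < C)
    (f_cont : {within `[C, +oo[, continuous f})
    (f_pos : {in `[C, +oo[, forall x, 0 < f x})
    (f_nondecr : {in `[C, +oo[ &, {homo f : x y / x <= y}})
    (f_rv : regularly_varying f) :
  let mu := @lebesgue_measure R in
  let F := fun t : R => \int[mu]_(s in `[C, t]) f s in
  {ae mu, forall theta : R, theta \in `]0, 1[ -> irrational theta ->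
    ((\int[mu]_(s in `[C, +oo[) ((f s)^-1)%:E < +oo)%E ->
       forall x : R, x \in `[0, 1[ ->
         rho theta x =o_\oo (fun n : nat => F (ln n%:R)))
    /\
    ((\int[mu]_(s in `[C, +oo[) ((f s)^-1)%:E = +oo)%E ->
       forall x : R, x \in `[0, 1[ ->
         ~ (rho theta x =o_\oo (fun n : nat => f (ln n%:R))))}.
Proof.
move=> mu F.
have [fin_int|inf_int] := ltP (\int[mu]_(s in `[C, +oo[) ((f s)^-1)%:E)%E +oo%E.
  apply: negligibleS (ae_rho_littleo f_cont f_pos f_nondecr f_rv fin_int) => theta H h; apply: H => /=.
  rewrite in_itv /= => t01 irr; split=> [_ x _|e]; first exact: h.
  by rewrite e ltxx in fin_int.
move: inf_int; rewrite leye_eq => /eqP inf_int.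
have ae2 := ae_rho_not_littleo C_gt0 f_pos f_nondecr inf_int.
apply: negligibleS ae2 => theta H h; apply: H => /=.
rewrite in_itv /= => t01 irr; split=> [//|_ x _]; exact: h.
Qed.
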